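(* Let $m$ and $n$ be non-negative integers and let $s=s_{m,n}$. Then, in the Hecke algebra $\mathcal{H}$ of the affine Weyl group $W$ of type $\widetilde{A}_2$, $$\underline{\mathbf{H}}_{\theta(m,n)s}=\mathbf{N}_{\theta(m,n)s}+v\,\underline{\mathbf{H}}_{\theta(m-1,n)}+v\,\underline{\mathbf{H}}_{\theta(m,n-1)},$$ where by convention $\underline{\mathbf{H}}_{\theta(a,b)}=0$ if $a<0$ or $b<0$.
   Context: $W$ is the Coxeter group generated by $S=\{s_0,s_1,s_2\}$ with relations $s_i^2=\mathrm{id}$, $(s_is_j)^3=\mathrm{id}$ for $i\ne j$; $\ell$ is the length function and $\le$ the Bruhat order. For any integer $k$, write $s_k$ for $s_{k \bmod 3}$. For integers $m,n\ge 0$ define $$\theta(m,n)=s_1s_2s_3\cdots s_{2m+1}s_{2m+2}s_{2m+1}s_{2m}\cdots s_{2m-2n+1}$$ (indices increase by one from $1$ to $2m+2$ and then decrease by one to $2m-2n+1$); this is a reduced expression, so $\ell(\theta(m,n))=2m+2n+3$. The right descent set of $\theta(m,n)$ consists of exactly two simple reflections, and $s_{m,n}\in S$ denotes the unique simple reflection with $\ell(\theta(m,n)s_{m,n})>\ell(\theta(m,n))$. $\mathcal{H}$ is the $\mathbb{Z}[v,v^{-1}]$-algebra generated by $\mathbf{H}_{s_0},\mathbf{H}_{s_1},\mathbf{H}_{s_2}$ with relations $\mathbf{H}_{s_i}^2=(v^{-1}-v)\mathbf{H}_{s_i}+1$ and $\mathbf{H}_{s_i}\mathbf{H}_{s_j}\mathbf{H}_{s_i}=\mathbf{H}_{s_j}\mathbf{H}_{s_i}\mathbf{H}_{s_j}$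 for $i\neq j$; it has standard basis $\{\mathbf{H}_w\}_{w\in W}$, where $\mathbf{H}_w=\mathbf{H}_{r_1}\cdots\mathbf{H}_{r_k}$ for any reduced expression $r_1\cdots r_k$ of $w$. $\{\underline{\mathbf{H}}_w\}_{w\in W}$ is the Kazhdan-Lusztig basis in Soergel's normalization: $\underline{\mathbf{H}}_w$ is the unique element of $\mathbf{H}_w+\sum_{x<w}v\mathbb{Z}[v]\mathbf{H}_x$ invariant under the ring involution $v\mapsto v^{-1}$, $\mathbf{H}_x\mapsto(\mathbf{H}_{x^{-1}})^{-1}$. (For example $\underline{\mathbf{H}}_s=\mathbf{H}_s+v$ for $s\in S$.) For $x\in W$, $\mathbf{N}_x=\sum_{z\le x}v^{\ell(x)-\ell(z)}\mathbf{H}_z$. *)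

(* Defs.v *)
From HB Require Import structures.
From mathcomp Require Import all_boot all_order all_algebra.
From mathcomp Require Import generic_quotient ring_quotient fraction.
From mathcomp Require Import boolp classical_sets fsbigop.
From mathcomp Require Import monalg.

Set Implicit Arguments.
Unset Strict Implicit.
Unset Printing Implicit Defensive.

Import GRing.Theory.

Local Open Scope ring_scope.
Local Open Scope quotient_scope.
Local Open Scope classical_set_scope.

(** Words in the three generators modulo the congruence generated by the
    Coxeter relations. As every generator is its own inverse, this monoid
    presentation is also the group presentation. *)

Inductive cox_rel : seq 'I_3 -> seq 'I_3 -> Prop :=
| CoxRefl r : cox_rel r r
| CoxSym r1 r2 : cox_rel r1 r2 -> cox_rel r2 r1
| CoxTrans r2 r1 r3 : cox_rel r1 r2 -> cox_rel r2 r3 -> cox_rel r1 r3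
| CoxCat r1 r1' r2 r2' :
    cox_rel r1 r1' -> cox_rel r2 r2' -> cox_rel (r1 ++ r2) (r1' ++ r2')
| CoxSquare i : cox_rel [:: i; i] [::]
| CoxBraid i j : i != j -> cox_rel [:: i; j; i; j; i; j] [::].

Definition cox_eq (r1 r2 : seq 'I_3) : bool := `[< cox_rel r1 r2 >].

Lemma cox_eq_equiv : equiv_class_of cox_eq.
Proof.
split=> [r|r1 r2|r2 r1 r3]; first exact/asboolP/CoxRefl.
  by apply/asboolP/asboolP => ?; apply: CoxSym.
by move=> /asboolP h1 /asboolP h2; apply/asboolP/(CoxTrans h1 h2).
Qed.

Canonical cox_equiv := EquivRelPack cox_eq_equiv.
Canonical cox_encModRel := defaultEncModRel cox_eq.

Definition W := {eq_quot cox_eq}.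
HB.instance Definition _ := EqQuotient.on W.
HB.instance Definition _ := Choice.on W.

Lemma W_piP r1 r2 : \pi_W r1 = \pi_W r2 <-> cox_rel r1 r2.
Proof.
by split=> [/eqmodP/asboolP|h] //; apply/eqmodP/asboolP.
Qed.

Definition W_one : W := \pi_W [::].
Definition W_mul (x y : W) : W := \pi_W (repr x ++ repr y).
Definition W_inv (x : W) : W := \pi_W (rev (repr x)).

Lemma W_pi_mul r1 r2 : W_mul (\pi_W r1) (\pi_W r2) = \pi_W (r1 ++ r2).
Proof. by apply/W_piP/CoxCat; apply/W_piP; rewrite reprK. Qed.

Lemma cox_rel_rev r1 r2 : cox_rel r1 r2 -> cox_rel (rev r1) (rev r2).
Proof.
elim=> {r1 r2} [r|r1 r2 _|r2 r1 r3 _ + _|r1 r1' r2 r2' _ h1 _ h2|i|i j ij].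
- exact: CoxRefl.
- exact: CoxSym.
- exact: CoxTrans.
- by rewrite !rev_cat; apply: CoxCat.
- exact: CoxSquare.
- by apply: CoxBraid; rewrite eq_sym.
Qed.

Lemma W_pi_inv r : W_inv (\pi_W r) = \pi_W (rev r).
Proof. by apply/W_piP/cox_rel_rev/W_piP; rewrite reprK. Qed.

Lemma cox_rel_catrev r : cox_rel (r ++ rev r) [::].
Proof.
elim: r => [|i r IHr]; first exact: CoxRefl.
rewrite rev_cons -cats1 cat_cons catA; apply: CoxTrans (CoxSquare i).
apply: (@CoxCat [:: i] [:: i] (_ ++ [:: i]) [:: i]); first exact: CoxRefl.
by apply: (@CoxCat _ [::] _ [:: i]) => //; apply: CoxRefl.
Qed.

Lemma W_mulA : associative W_mul.
Proof.
elim/quotW=> r1; elim/quotW=> r2; elim/quotW=> r3.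
by rewrite (W_pi_mul r2 r3) (W_pi_mul r1 r2) !W_pi_mul catA.
Qed.

Lemma W_mul1 : left_id W_one W_mul.
Proof. by move=> x; rewrite -[x]reprK W_pi_mul. Qed.

Lemma W_mulg1 : right_id W_one W_mul.
Proof. by move=> x; rewrite -[x]reprK W_pi_mul cats0. Qed.

Lemma W_mulV : left_inverse W_one W_inv W_mul.
Proof.
move=> x; rewrite -[x]reprK W_pi_inv W_pi_mul; apply/W_piP.
by rewrite -{2}[repr x]revK; apply: cox_rel_catrev.
Qed.

Lemma W_mulgV : right_inverse W_one W_inv W_mul.
Proof.
by move=> x; rewrite -[x]reprK W_pi_inv W_pi_mul; apply/W_piP/cox_rel_catrev.
Qed.

HB.instance Definition _ :=
  isGroup.Build W W_mulA W_mul1 W_mulg1 W_mulV W_mulgV.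

Definition s_ (i : 'I_3) : W := \pi_W [:: i].

Definition expr (r : seq 'I_3) : W := (\prod_(i <- r) s_ i)%g.

Lemma exprE r : expr r = \pi_W r.
Proof.
rewrite /expr; elim: r => [|i r IHr]; first by rewrite big_nil.
by rewrite big_cons IHr; apply: W_pi_mul.
Qed.

Lemma has_expr (w : W) :
  exists n, `[< exists r : seq 'I_3, size r = n /\ expr r = w >].
Proof.
by exists (size (repr w)); apply/asboolP; exists (repr w); rewrite exprE reprK.
Qed.

Definition ell (w : W) : nat := ex_minn (has_expr w).

Definition reduced (r : seq 'I_3) (w : W) : Prop :=
  expr r = w /\ size r = ell w.

Definition reflection (t : W) : Prop :=
  exists x i, t = (x * s_ i * x^-1)%g.

Inductive bruhat_le : W -> W -> Prop :=
| BruhatRefl x : bruhat_le x x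
| BruhatStep x y t : bruhat_le x y -> reflection t ->
    (ell y < ell (y * t)%g)%N -> bruhat_le x (y * t)%g.

Definition bruhat_lt (x w : W) : Prop := bruhat_le x w /\ x <> w.

(** [Z[v, v^-1]] is the subring of the fraction field of [Z[v]] consisting of
    the elements [p / v ^ n]; the formal variable ['X] of [{poly int}] is [v]. *)

Local Notation "p %:F" := (tofrac p).

Definition is_laurent : {pred {fraction {poly int}}} :=
  fun x => `[< exists (p : {poly int}) (n : nat), x = p%:F / 'X%:F ^+ n >].

Lemma Xfrac_neq0 n : ('X : {poly int})%:F ^+ n != 0.
Proof. by rewrite expf_neq0 // tofrac_eq0 polyX_eq0. Qed.

Lemma is_laurent_subring : subring_closed is_laurent.
Proof.
split.
- by apply/asboolP; exists 1, 0; rewrite tofrac1 expr0 divr1.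
- move=> x y /asboolP[p [m ->]] /asboolP[q [n ->]]; apply/asboolP.
  exists (p * 'X^n - q * 'X^m), (m + n)%N.
  by rewrite exprD -mulNr addf_div ?Xfrac_neq0 // tofracB !tofracM !tofracXn mulNr.
- move=> x y /asboolP[p [m ->]] /asboolP[q [n ->]]; apply/asboolP.
  by exists (p * q), (m + n)%N; rewrite exprD mulf_div tofracM.
Qed.

HB.instance Definition _ := GRing.isSubringClosed.Build
  {fraction {poly int}} is_laurent is_laurent_subring.

Record laurent := Laurent {
  laurent_val :> {fraction {poly int}};
  laurent_valP : laurent_val \in is_laurent }.

HB.instance Definition _ := [isSub for laurent_val].
HB.instance Definition _ := [Choice of laurent by <:].
HB.instance Definition _ := [SubChoice_isSubComNzRing of laurent by <:].

Definition laurent_unit : {pred laurent} :=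
  fun x => `[< exists y, y * x = 1 >].
Definition laurent_inv (x : laurent) : laurent := xget x [set y | y * x = 1].

Lemma laurent_mulV : {in laurent_unit, left_inverse 1 laurent_inv *%R}.
Proof. by move=> x /asboolP; apply: (@xgetPex _ x [set y | y * x = 1]). Qed.

Lemma laurent_unitPl (x y : laurent) : y * x = 1 -> laurent_unit x.
Proof. by move=> yx; apply/asboolP; exists y. Qed.

Lemma laurent_invr_out : {in [predC laurent_unit], laurent_inv =1 id}.
Proof.
by move=> x /asboolPn nx; apply: xgetPN => y yx; apply: nx; exists y.
Qed.

HB.instance Definition _ := GRing.ComNzRing_hasMulInverse.Build laurent
  laurent_mulV laurent_unitPl laurent_invr_out.

Lemma laurent_integral : GRing.integral_domain_axiom laurent.
Proof.
move=> x y /(congr1 val); rewrite rmorphM rmorph0 => /eqP.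
by rewrite mulf_eq0 => /orP[] /eqP h; apply/orP; [left|right];
  apply/eqP/val_inj; rewrite h rmorph0.
Qed.

HB.instance Definition _ :=
  GRing.ComUnitRing_isIntegral.Build laurent laurent_integral.

Lemma v_subproof : 'X%:F \in is_laurent.
Proof. by apply/asboolP; exists 'X, 0; rewrite expr0 divr1. Qed.

Lemma vV_subproof : ('X%:F)^-1 \in is_laurent.
Proof. by apply/asboolP; exists 1, 1; rewrite tofrac1 div1r expr1. Qed.

Definition v : laurent := Laurent v_subproof.

Lemma v_unit : v \is a GRing.unit.
Proof.
apply: (@laurent_unitPl _ (Laurent vV_subproof)); apply: val_inj.
by rewrite rmorphM rmorph1 /= mulVf // -[_%:F]expr1 Xfrac_neq0.
Qed.

Definition poly_v (p : {poly int}) : laurent := (map_poly intr p).[v].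

(** The Hecke algebra is the free [Z[v, v^-1]]-algebra on three generators
    (monoid algebra of the free monoid on ['I_3]) modulo the two-sided ideal
    generated by the quadratic and the braid relations. *)

Definition free_alg := {malg laurent[{fmonom 'I_3}]}.
HB.instance Definition _ := GRing.Lalgebra.on free_alg.

Lemma malgC_comm (c : laurent) (x : free_alg) : c%:MP * x = x * c%:MP.
Proof.
rewrite mul_malgC malgZ_def malgM_def fgmulgU; apply: eq_bigr => k _.
by rewrite mulm1 mulrC.
Qed.

Lemma free_alg_scaleAr (c : laurent) (x y : free_alg) :
  c *: (x * y) = x * (c *: y).
Proof. by rewrite -!mul_malgC !mulrA malgC_comm. Qed.

HB.instance Definition _ :=
  GRing.Lalgebra_isAlgebra.Build laurent free_alg free_alg_scaleAr.

Definition X_ (i : 'I_3) : free_alg := << fmu i >>.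

Inductive hecke_ideal : free_alg -> Prop :=
| HIdealQuad i :
    hecke_ideal (X_ i ^+ 2 - ((v^-1 - v) *: X_ i + 1))
| HIdealBraid i j : i != j ->
    hecke_ideal (X_ i * X_ j * X_ i - X_ j * X_ i * X_ j)
| HIdeal0 : hecke_ideal 0
| HIdealSub x y : hecke_ideal x -> hecke_ideal y -> hecke_ideal (x - y)
| HIdealMul a x b : hecke_ideal x -> hecke_ideal (a * x * b).

Definition hecke_idealb : {pred free_alg} := fun x => `[< hecke_ideal x >].

Lemma hecke_ideal_zmod : zmod_closed hecke_idealb.
Proof.
split=> [|x y /asboolP hx /asboolP hy]; apply/asboolP; first exact: HIdeal0.
exact: HIdealSub.
Qed.

HB.instance Definition _ :=
  GRing.isZmodClosed.Build free_alg hecke_idealb hecke_ideal_zmod.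

Definition hecke := {ideal_quot hecke_idealb}.
HB.instance Definition _ := GRing.Zmodule.on hecke.
HB.instance Definition _ := EqQuotient.on hecke.

Lemma hecke_piP x y : \pi_hecke x = \pi_hecke y <-> hecke_ideal (x - y).
Proof.
by split=> [/eqmodP/asboolP|h] //; apply/eqmodP/asboolP.
Qed.

Lemma hecke_pi0 : \pi_hecke 0 = 0.
Proof. by rewrite !piE. Qed.

Lemma hecke_pi_add x y : \pi_hecke x + \pi_hecke y = \pi_hecke (x + y).
Proof. by rewrite !piE. Qed.

Definition hecke_one : hecke := \pi_hecke 1.
Definition hecke_mul (x y : hecke) : hecke := \pi_hecke (repr x * repr y).
Definition hecke_scale (c : laurent) (x : hecke) : hecke :=
  \pi_hecke (c *: repr x).

Lemma hecke_pi_mul x y :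
  hecke_mul (\pi_hecke x) (\pi_hecke y) = \pi_hecke (x * y).
Proof.
apply/hecke_piP.
have [hx hy] : hecke_ideal (repr (\pi_hecke x) - x)
             /\ hecke_ideal (repr (\pi_hecke y) - y).
  by split; apply/hecke_piP; rewrite reprK.
move: (repr (\pi_hecke x)) (repr (\pi_hecke y)) hx hy => x' y' hx hy.
have -> : x' * y' - x * y = 1 * (x' - x) * y' - (- x) * (y' - y) * 1.
  by rewrite mul1r mulr1 mulNr opprK mulrBl mulrBr addrA subrK.
by apply: HIdealSub; apply: HIdealMul.
Qed.

Lemma hecke_pi_scale c x :
  hecke_scale c (\pi_hecke x) = \pi_hecke (c *: x).
Proof.
apply/hecke_piP.
have hx : hecke_ideal (repr (\pi_hecke x) - x).
  by apply/hecke_piP; rewrite reprK.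
rewrite -scalerBr -[_ - x]mul1r scalerAl -[X in hecke_ideal X]mulr1.
exact: HIdealMul.
Qed.

(* [X_ i |-> v^-1] defines a character of the free algebra killing the ideal. *)
Definition char_monom (k : {fmonom 'I_3}) : laurent := v^-1 ^+ size k.

Lemma char_monom_is_mmorphism : mmorphism char_monom.
Proof.
by split=> [k l|]; rewrite /char_monom (fm1, fmM) ?size_cat ?exprD ?expr0.
Qed.

HB.instance Definition _ :=
  isMultiplicative.Build _ _ char_monom char_monom_is_mmorphism.

Definition free_char (x : free_alg) : laurent := mmap idfun char_monom x.

Lemma free_charX i : free_char (X_ i) = v^-1.
Proof. by rewrite /free_char mmapU /char_monom fmU expr1 mul1r. Qed.

Lemma free_charM x y : free_char (x * y) = free_char x * free_char y.
Proof. exact: rmorphM. Qed.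

Lemma free_charB x y : free_char (x - y) = free_char x - free_char y.
Proof. exact: raddfB. Qed.

Lemma hecke_ideal_char x : hecke_ideal x -> free_char x = 0.
Proof.
elim=> {x} [i|i j _||x y _ hx _ hy|a x b _ hx].
- rewrite /free_char !(rmorphB, rmorphD, rmorphXn, rmorph1) /= mmapZ.
  rewrite -/(free_char _) free_charX mulrBl mulrV ?v_unit //.
  by rewrite subrK expr2 subrr.
- by rewrite free_charB !free_charM !free_charX subrr.
- exact: raddf0.
- by rewrite free_charB hx hy subrr.
- by rewrite !free_charM hx mulr0 mul0r.
Qed.

Lemma hecke_ideal1 : ~ hecke_ideal 1.
Proof.
by move=> /hecke_ideal_char /eqP; rewrite [free_char 1]mmap1 oner_eq0.
Qed.

Lemma hecke_mulA : associative hecke_mul.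
Proof.
elim/quotW=> x; elim/quotW=> y; elim/quotW=> z.
by rewrite (hecke_pi_mul y z) (hecke_pi_mul x y) !hecke_pi_mul mulrA.
Qed.

Lemma hecke_mul1 : left_id hecke_one hecke_mul.
Proof. by elim/quotW=> x; rewrite hecke_pi_mul mul1r. Qed.

Lemma hecke_mulr1 : right_id hecke_one hecke_mul.
Proof. by elim/quotW=> x; rewrite hecke_pi_mul mulr1. Qed.

Lemma hecke_mulDl : left_distributive hecke_mul +%R.
Proof.
elim/quotW=> x; elim/quotW=> y; elim/quotW=> z.
by rewrite hecke_pi_add (hecke_pi_mul x z) (hecke_pi_mul y z) hecke_pi_mul
           hecke_pi_add mulrDl.
Qed.

Lemma hecke_mulDr : right_distributive hecke_mul +%R.
Proof.
elim/quotW=> x; elim/quotW=> y; elim/quotW=> z.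
by rewrite hecke_pi_add (hecke_pi_mul x z) (hecke_pi_mul x y) hecke_pi_mul
           hecke_pi_add mulrDr.
Qed.

Lemma hecke_one_neq0 : hecke_one != 0.
Proof.
apply/eqP; rewrite -hecke_pi0 => /hecke_piP; rewrite subr0.
exact: hecke_ideal1.
Qed.

HB.instance Definition _ := GRing.Zmodule_isNzRing.Build hecke
  hecke_mulA hecke_mul1 hecke_mulr1 hecke_mulDl hecke_mulDr hecke_one_neq0.

Lemma hecke_scaleA a b x :
  hecke_scale a (hecke_scale b x) = hecke_scale (a * b) x.
Proof.
by elim/quotW: x => x; rewrite (hecke_pi_scale b x) !hecke_pi_scale scalerA.
Qed.

Lemma hecke_scale1 : left_id 1 hecke_scale.
Proof. by elim/quotW=> x; rewrite hecke_pi_scale scale1r. Qed.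

Lemma hecke_scaleDr : right_distributive hecke_scale +%R.
Proof.
move=> c; elim/quotW=> x; elim/quotW=> y.
by rewrite hecke_pi_add !hecke_pi_scale hecke_pi_add scalerDr.
Qed.

Lemma hecke_scaleDl x : {morph hecke_scale^~ x : a b / a + b}.
Proof.
move=> a b; elim/quotW: x => x.
by rewrite !hecke_pi_scale hecke_pi_add scalerDl.
Qed.

HB.instance Definition _ := GRing.Zmodule_isLmodule.Build laurent hecke
  hecke_scaleA hecke_scale1 hecke_scaleDr hecke_scaleDl.

Lemma hecke_scaleAl c x y :
  hecke_scale c (hecke_mul x y) = hecke_mul (hecke_scale c x) y.
Proof.
elim/quotW: x => x; elim/quotW: y => y.
by rewrite (hecke_pi_scale c x) !hecke_pi_mul hecke_pi_scale scalerAl.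
Qed.

HB.instance Definition _ :=
  GRing.Lmodule_isLalgebra.Build laurent hecke hecke_scaleAl.

Lemma hecke_scaleAr c x y :
  hecke_scale c (hecke_mul x y) = hecke_mul x (hecke_scale c y).
Proof.
elim/quotW: x => x; elim/quotW: y => y.
by rewrite (hecke_pi_scale c y) !hecke_pi_mul hecke_pi_scale scalerAr.
Qed.

HB.instance Definition _ :=
  GRing.Lalgebra_isAlgebra.Build laurent hecke hecke_scaleAr.

Definition hecke_unit : {pred hecke} :=
  fun x => `[< exists y, y * x = 1 /\ x * y = 1 >].
Definition hecke_inv (x : hecke) : hecke :=
  xget x [set y | y * x = 1 /\ x * y = 1].

Lemma hecke_invP x : hecke_unit x -> hecke_inv x * x = 1 /\ x * hecke_inv x = 1.
Proof.
by move=> /asboolP; apply: (@xgetPex _ x [set y | y * x = 1 /\ x * y = 1]).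
Qed.

Lemma hecke_mulV : {in hecke_unit, left_inverse 1 hecke_inv *%R}.
Proof. by move=> x /hecke_invP[]. Qed.

Lemma hecke_mulrV : {in hecke_unit, right_inverse 1 hecke_inv *%R}.
Proof. by move=> x /hecke_invP[]. Qed.

Lemma hecke_unitP (x y : hecke) : y * x = 1 /\ x * y = 1 -> hecke_unit x.
Proof. by move=> yx; apply/asboolP; exists y. Qed.

Lemma hecke_invr_out : {in [predC hecke_unit], hecke_inv =1 id}.
Proof.
by move=> x /asboolPn nx; apply: xgetPN => y yx; apply: nx; exists y.
Qed.

HB.instance Definition _ := GRing.NzRing_hasMulInverse.Build hecke
  hecke_mulV hecke_mulrV hecke_unitP hecke_invr_out.

Definition H_ (i : 'I_3) : hecke := \pi_hecke (X_ i).

(* The reduced expression used is immaterial (Matsumoto's theorem). *)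
Definition std (w : W) : hecke :=
  \prod_(i <- xget [::] [set r | reduced r w]) H_ i.

Definition is_bar (f : {rmorphism hecke -> hecke}) : Prop :=
  f v%:A = v^-1%:A /\ forall x : W, f (std x) = (std x^-1%g)^-1.

(* Exactly one [f] satisfies [is_bar]: [v], [v^-1] and the [std x] generate the
   ring [hecke], and every [std x] is invertible. *)
Definition bar_invariant (h : hecke) : Prop :=
  exists f : {rmorphism hecke -> hecke}, is_bar f /\ f h = h.

(* The sums over lower Bruhat intervals are finite-support sums; these intervals
   are finite. *)
Definition is_KL (w : W) (h : hecke) : Prop :=
  (exists p : W -> {poly int},
     h = std w + \sum_(x \in [set x | bruhat_lt x w]) (v * poly_v (p x)) *: std x)
  /\ bar_invariant h.

(* By the theorem of Kazhdan and Lusztig there is exactly one such [h]; the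
   default value [0] of [xget] is never used. *)
Definition KL (w : W) : hecke := xget 0 [set h | is_KL w h].

Definition N_ (x : W) : hecke :=
  \sum_(z \in [set z | bruhat_le z x]) v ^+ (ell x - ell z) *: std z.

(* [theta_word m n] is 1, 2, ..., 2m+2, 2m+1, ..., 2m-2n+1 (modulo 3). *)
Definition index_mod3 (k : int) : 'I_3 := inord `|(k %% 3)%Z|%N.

Definition theta_word (m n : nat) : seq 'I_3 :=
  [seq index_mod3 (1 + i%:Z) | i <- iota 0 (2 * m + 2)] ++
  [seq index_mod3 ((2 * m + 1)%N%:Z - j%:Z) | j <- iota 0 (2 * n + 1)].

Definition theta (m n : nat) : W := expr (theta_word m n).

Definition KL_theta (a b : int) : hecke :=
  match a, b with
  | Posz m, Posz n => KL (theta m n)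
  | _, _ => 0
  end.

(* Main.v *)
From HB Require Import structures.
Require Import Defs.
From mathcomp Require Import all_boot all_order all_algebra.
From mathcomp Require Import finmap.
From mathcomp Require Import boolp classical_sets cardinality fsbigop.
From mathcomp Require Import generic_quotient ring_quotient fraction monalg.
From mathcomp Require Import zify ring.
Set Implicit Arguments.
Unset Strict Implicit.
Unset Printing Implicit Defensive.
Import GRing.Theory Num.Theory Order.TTheory.
Local Open Scope ring_scope.

(** The product N_theta(m,n) (H_s + v) is almost the right-hand side: the idea is to
sum such products so that the error telescopes.  Put
  K(m,n) = N_theta(m,n) + v^2 N_theta(m-1,n-1) + v^4 N_theta(m-2,n-2) + ...,
with N_theta(a,b) = 0 when a or b is negative, and let t and u be the two
generators other than s = s_(m,n).  Everything rests on the three product formulas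
  N_theta(m,n) (H_s + v) = N_(theta(m,n)s) + v N_theta(m-1,n) + v N_theta(m,n-1)
                           - v^2 N_(theta(m-1,n-1)s),
  N_(theta(m,n)s) (H_t + v) + v N_(theta(m-1,n)s)
                         = N_theta(m+1,n) + N_theta(m,n) + N_theta(m-1,n+1),
and the mirror image of the second for u ([Ntheta_mul_s], [Ntheta_s_mul_t],
[Ntheta_s_mul_u]).  The first one telescopes to ([Ktheta_mul_s])
  K(m,n) (H_s + v) = G(m,n) := N_(theta(m,n)s) + v K(m-1,n) + v K(m,n-1),
and the second gives ([Ktheta_s_mul_t], [Ktheta_s_mul_u])
  G(m,n) (H_t + v) = K(m+1,n) + K(m,n) + K(m-1,n+1) + K(m,n-1).
All H_i + v are invariant under the bar involution, so by induction on m + n every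
K(m,n), and then every G(m,n), is invariant ([bar_fixed_Ktheta]); the induction
starts from N_(s1 s2 s1) = (H_1 + v)(H_2 + v)(H_1 + v) - (H_1 + v).  The
coefficients of K(m,n) and G(m,n) have the triangular shape that characterizes
Kazhdan-Lusztig elements, whence KL_theta(m,n) = K(m,n) and
KL_(theta(m,n)s) = G(m,n), which is the theorem.

The coefficients of N_theta(m,n) and N_(theta(m,n)s) are powers of v on lower Bruhat
intervals, so the product formulas amount to identities between such intervals.
They are seen in the tessellation of the plane by alcoves, on which W acts simply
transitively: an element lies below theta(m,n) if and only if the vertex of colour
n - m of its alcove lies in the hexagon spanned by the finite Weyl group orbit of a
dominant weight ([bruhat_theta]), and unions and intersections of neighbouring
hexagons are computed with inequalities between integer coordinates.

The same alcove model supplies the general facts on W and its Hecke algebra: the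
length function counts separating hyperplanes, geometric reflections give the
exchange and lifting properties of the Bruhat order, the six alcoves around a vertex
give Matsumoto's theorem, and functions on W carry a representation of the Hecke
algebra that makes the coefficients in the standard basis well defined. *)

(** * Alcoves of the plane *)

Definition gen0 : 'I_3 := @Ordinal 3 0 isT.
Definition gen1 : 'I_3 := @Ordinal 3 1 isT.
Definition gen2 : 'I_3 := @Ordinal 3 2 isT.

Lemma ord3_ind (P : 'I_3 -> Prop) : P gen0 -> P gen1 -> P gen2 -> forall i, P i.
Proof.
move=> h0 h1 h2 [[|[|[|k]]] hk] //.
- by rewrite (_ : Ordinal hk = gen0) //; apply: val_inj.
- by rewrite (_ : Ordinal hk = gen1) //; apply: val_inj.
- by rewrite (_ : Ordinal hk = gen2) //; apply: val_inj.
Qed.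

(** The finite Weyl group S_3, each element named by a reduced word: it is the linear part of
the affine transformation carrying the fundamental alcove to the given one. *)
Inductive orient := Oe | O1 | O2 | O12 | O21 | O121.

(** The alcove obtained from the fundamental one by [dir] followed by the translation
by px alpha_1 + py alpha_2; this translation vector is its vertex of colour 0. *)
Record alcove := Alcove { px : int; py : int; dir : orient }.

(** Crossing the wall of type [i], that is the wall opposite to the vertex of colour [i].
Alcoves are the images of the fundamental one under W, and on them this is right
multiplication by [s_ i].  Types 1 and 2 keep the vertex of colour 0. *)
Definition act (A : alcove) (i : 'I_3) : alcove :=
  let: Alcove x y o := A in
  match val i with
  | 0%N => match o with
         | Oe => Alcove (x + 1) (y + 1) O121
         | O1 => Alcove x (y + 1) O21
         | O2 => Alcove (x + 1) y O12
         | O12 => Alcove (x - 1) y O2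
         | O21 => Alcove x (y - 1) O1
         | O121 => Alcove (x - 1) (y - 1) Oe
         end
  | 1%N => Alcove x y
      match o with Oe => O1 | O1 => Oe | O2 => O21 | O21 => O2
                 | O12 => O121 | O121 => O12 end
  | _ => Alcove x y
      match o with Oe => O2 | O2 => Oe | O1 => O12 | O12 => O1
                 | O21 => O121 | O121 => O21 end
  end.

Definition alcove0 := Alcove 0 0 Oe.

(** The integer parts of the positive roots alpha_1, alpha_2 and alpha_1 + alpha_2 on the
alcove (its Shi coordinates).  They separate the alcoves, and each counts, up to sign, the
parallel hyperplanes between the alcove and the fundamental one. *)
Definition shi_a (A : alcove) : int :=
  2 * px A - py A - match dir A with Oe | O2 | O21 => 0 | _ => 1 end.
Definition shi_b (A : alcove) : int :=
  2 * py A - px A - match dir A with Oe | O1 | O12 => 0 | _ => 1 end.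
Definition shi_c (A : alcove) : int :=
  px A + py A - match dir A with Oe | O1 | O2 => 0 | _ => 1 end.

(** The number of hyperplanes separating the alcove from the fundamental one. *)
Definition len (A : alcove) : nat := (`|shi_a A| + `|shi_b A| + `|shi_c A|)%N.

Ltac unfold_shi := rewrite /len /shi_a /shi_b /shi_c /=.

Lemma actK i : involutive (act^~ i).
Proof.
elim/ord3_ind: i => -[x y []] //=; congr Alcove; lia.
Qed.

Lemma act_braid A i j : i != j ->
  act (act (act A i) j) i = act (act (act A j) i) j.
Proof.
move: A; elim/ord3_ind: i; elim/ord3_ind: j => -[x y []] //= _;
  congr Alcove; lia.
Qed.

(** The third coordinate is the sum of the others or that sum plus 1, according to the
two shapes of triangle; the shape decides in which direction each wall can be crossed. *)
Definition wall_step (a b c a' b' c' : int) : Prop :=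
  (c = a + b /\ [\/ [/\ a' = a - 1, b' = b & c' = c],
                    [/\ a' = a, b' = b - 1 & c' = c] |
                    [/\ a' = a, b' = b & c' = c + 1]]) \/
  (c = a + b + 1 /\ [\/ [/\ a' = a + 1, b' = b & c' = c],
                    [/\ a' = a, b' = b + 1 & c' = c] |
                    [/\ a' = a, b' = b & c' = c - 1]]).

Lemma act_step A i : wall_step (shi_a A) (shi_b A) (shi_c A)
                       (shi_a (act A i)) (shi_b (act A i)) (shi_c (act A i)).
Proof.
move: A; elim/ord3_ind: i => -[x y []]; rewrite /wall_step; unfold_shi;
 first [left; split; [lia|] | right; split; [lia|]];
 first [by apply: Or31; split; lia | by apply: Or32; split; lia | by apply: Or33; split; lia].
Qed.

Lemma len_act A i :
  len (act A i) = (len A).+1 \/ len A = (len (act A i)).+1.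
Proof.
by rewrite /len; case: (act_step A i) => [[_ []]|[_ []]] [-> -> ->]; lia.
Qed.

Lemma len0 A : len A = 0%N -> A = alcove0.
Proof.
rewrite /len => h.
have {h} [] : [/\ shi_a A = 0, shi_b A = 0 & shi_c A = 0] by split; lia.
case: A => x y o; unfold_shi => ha hb hc.
have [x0 y0] : x = 0 /\ y = 0 by case: o ha hb hc => /= *; lia.
by move: ha hb hc; rewrite x0 y0; case: o.
Qed.

(** An alcove has one wall in each of the three directions. *)
Lemma walls A : exists i j k : 'I_3,
  [/\ shi_c A = shi_a A + shi_b A,
      shi_a (act A i) = shi_a A - 1 /\ shi_b (act A i) = shi_b A /\ shi_c (act A i) = shi_c A,
      shi_b (act A j) = shi_b A - 1 /\ shi_a (act A j) = shi_a A /\ shi_c (act A j) = shi_c A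
    & shi_c (act A k) = shi_c A + 1 /\ shi_a (act A k) = shi_a A /\ shi_b (act A k) = shi_b A] \/
  [/\ shi_c A = shi_a A + shi_b A + 1,
      shi_a (act A i) = shi_a A + 1 /\ shi_b (act A i) = shi_b A /\ shi_c (act A i) = shi_c A,
      shi_b (act A j) = shi_b A + 1 /\ shi_a (act A j) = shi_a A /\ shi_c (act A j) = shi_c A
    & shi_c (act A k) = shi_c A - 1 /\ shi_a (act A k) = shi_a A /\ shi_b (act A k) = shi_b A].
Proof.
case: A => x y [].
- by exists gen1, gen2, gen0; left; unfold_shi; split; lia.
- by exists gen1, gen0, gen2; right; unfold_shi; split; lia.
- by exists gen0, gen2, gen1; right; unfold_shi; split; lia.
- by exists gen0, gen1, gen2; left; unfold_shi; split; lia.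
- by exists gen2, gen0, gen1; left; unfold_shi; split; lia.
- by exists gen2, gen1, gen0; right; unfold_shi; split; lia.
Qed.

(** If no step decreased the length, then for the first shape the coordinates would satisfy
a <= 0, b <= 0 and 0 <= a + b, so the alcove would be the fundamental one; similarly for
the second shape, where a, b >= 0 and a + b + 1 <= 0 is impossible. *)
Lemma len_descent A : (0 < len A)%N -> exists i, (len (act A i) < len A)%N.
Proof.
rewrite /len => h; have [i [j [k]]] := walls A.
case=> -[hc [ha1 [ha2 ha3]] [hb1 [hb2 hb3]] [hc1 [hc2 hc3]]].
  case: (boolP (0 < shi_a A)) => ha; first by exists i; lia.
  case: (boolP (0 < shi_b A)) => hb; first by exists j; lia.
  by exists k; lia.
case: (boolP (shi_a A < 0)) => ha; first by exists i; lia.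
case: (boolP (shi_b A < 0)) => hb; first by exists j; lia.
by exists k; lia.
Qed.

(** * Reflections and the exchange property *)

(** alpha_1, alpha_2 and alpha_1 + alpha_2. *)
Inductive root := Ra | Rb | Rc.

(** The affine reflection in the hyperplane on which the root takes the value [k].  It acts
on alcoves from the left, hence commutes with crossing walls of a given type. *)
Definition refl (r : root) (k : int) (A : alcove) : alcove :=
  let: Alcove x y o := A in
  match r with
  | Ra => Alcove (y - x + k) y
           match o with Oe => O1 | O1 => Oe | O2 => O12 | O12 => O2
                      | O21 => O121 | O121 => O21 end
  | Rb => Alcove x (x - y + k)
           match o with Oe => O2 | O2 => Oe | O1 => O21 | O21 => O1
                      | O12 => O121 | O121 => O12 end
  | Rc => Alcove (k - y) (k - x)
           match o with Oe => O121 | O121 => Oe | O1 => O12 | O12 => O1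
                      | O2 => O21 | O21 => O2 end
  end.

Lemma refl_act r k A i : refl r k (act A i) = act (refl r k A) i.
Proof.
by move: A; elim/ord3_ind: i; case: r => -[x y []] //=; congr Alcove; lia.
Qed.

Lemma shi_sum A : shi_c A = shi_a A + shi_b A \/ shi_c A = shi_a A + shi_b A + 1.
Proof. by case: (act_step A gen0) => -[]; auto. Qed.

Lemma shi_inj A B : shi_a A = shi_a B -> shi_b A = shi_b B -> shi_c A = shi_c B -> A = B.
Proof.
case: A B => [x y o] [x' y' o']; unfold_shi => ha hb hc.
have [-> [-> ->]] // : x = x' /\ y = y' /\ o = o'.
by case: o o' ha hb hc => -[] /= *; do !split=> //; (lia || (exfalso; lia)).
Qed.

Lemma shi_refl r k A :
  match r with
  | Ra => [/\ shi_a (refl r k A) = 2 * k - 1 - shi_a A,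
              shi_b (refl r k A) = shi_c A - k & shi_c (refl r k A) = shi_b A + k]
  | Rb => [/\ shi_a (refl r k A) = shi_c A - k,
              shi_b (refl r k A) = 2 * k - 1 - shi_b A & shi_c (refl r k A) = shi_a A + k]
  | Rc => [/\ shi_a (refl r k A) = k - 1 - shi_b A,
              shi_b (refl r k A) = k - 1 - shi_a A & shi_c (refl r k A) = 2 * k - 1 - shi_c A]
  end.
Proof. by case: A => x y []; case: r; unfold_shi; split; lia. Qed.

Definition coord (r : root) A := match r with Ra => shi_a A | Rb => shi_b A | Rc => shi_c A end.

(** A reflection increases the length exactly when the alcove lies on the same side of the
mirror as the fundamental one; the mirrors with 0 < k have it on their negative side. *)
Lemma len_refl r k A :
  (len A < len (refl r k A))%N = (if 0 < k then coord r A < k else k <= coord r A).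
Proof.
have := shi_refl r k A; have := shi_sum A; rewrite /len.
case: r => /= + [-> -> ->]; move: (shi_a A) (shi_b A) (shi_c A) => a b c h;
 case: ifP => hk; apply/idP/idP => h'; lia.
Qed.

(** An alcove and its neighbour are mirror images in the line of their common wall. *)
Lemma act_refl A i : exists r k, act A i = refl r k A.
Proof.
have refl_of r k : (match r with
  | Ra => [/\ shi_a (act A i) = 2 * k - 1 - shi_a A,
              shi_b (act A i) = shi_c A - k & shi_c (act A i) = shi_b A + k]
  | Rb => [/\ shi_a (act A i) = shi_c A - k,
              shi_b (act A i) = 2 * k - 1 - shi_b A & shi_c (act A i) = shi_a A + k]
  | Rc => [/\ shi_a (act A i) = k - 1 - shi_b A,
              shi_b (act A i) = k - 1 - shi_a A & shi_c (act A i) = 2 * k - 1 - shi_c A]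
  end) -> act A i = refl r k A.
  by have := shi_refl r k A; case: r => -[h1 h2 h3] [? ? ?]; apply: shi_inj; lia.
case: (act_step A i) => -[hc []] [h1 h2 h3].
- by exists Ra, (shi_a A); apply: refl_of; split; lia.
- by exists Rb, (shi_b A); apply: refl_of; split; lia.
- by exists Rc, (shi_c A + 1); apply: refl_of; split; lia.
- by exists Ra, (shi_a A + 1); apply: refl_of; split; lia.
- by exists Rb, (shi_b A + 1); apply: refl_of; split; lia.
- by exists Rc, (shi_c A); apply: refl_of; split; lia.
Qed.

(** Crossing a wall changes the side of the mirror only when that wall lies in the mirror,
and then the neighbour is the mirror image. *)
Lemma refl_exchange r k A i : (len A < len (refl r k A))%N ->
  refl r k A <> act A i -> (len (act A i) < len (refl r k (act A i)))%N.
Proof.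
rewrite !len_refl => side ne.
have [//|flip] := boolP (if _ then _ else _); exfalso; apply: ne; apply: shi_inj;
 have := shi_refl r k A; case: r side flip => /= side flip [e1 e2 e3];
 case: (act_step A i) => -[hc []] [h1 h2 h3]; move: side flip; case: ifP => *; lia.
Qed.

Lemma act_neq A i j : i != j -> act A i <> act A j.
Proof.
move: A; elim/ord3_ind: i; elim/ord3_ind: j => -[x y []] //= _ [] *; lia.
Qed.

(** * The star of a vertex and reduced galleries *)

Definition desc A i := (len (act A i) < len A)%N.
Lemma act_nbraid A i j : i != j -> act (act A i) j <> act (act A j) i.
Proof.
by move: A; elim/ord3_ind: i; elim/ord3_ind: j => -[x y []] //= _ [].
Qed.

(** Let L be the line of the wall of type [i] of [A].  Among the six alcoves around the vertex
common to the walls of types [i] and [j], the alcoves [act A j] and [act (act A j) i] are on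
the same side of L as [A], and their mirror images are the other two displayed alcoves. *)
Lemma act_par A i j : i != j -> (len A < len (act A i))%N ->
  (len (act A j) < len (act (act A i) j))%N /\
  (len (act (act A j) i) < len (act (act (act A i) j) i))%N.
Proof.
move=> ij; have [r [k E]] := act_refl A i; rewrite E -!refl_act => h.
have h1 : (len (act A j) < len (refl r k (act A j)))%N.
  by apply: refl_exchange => //; rewrite -E; apply: act_neq.
split=> //; apply: refl_exchange => //; rewrite refl_act -E.
exact: act_nbraid.
Qed.

(** Three lines pass through a vertex, and each is crossed at two opposite places when one
walks around the six alcoves of its star.  So the descents at opposite places agree; and when
[A] has both descents, the length goes on decreasing along either half of the star. *)
Lemma desc_star A i j : i != j ->
  [/\ desc (act (act A j) i) j = desc A i, desc (act (act A i) j) i = desc A j,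
      desc (act A j) i = desc (act A i) j
    & desc A i = desc A j -> desc (act A i) j = desc A i].
Proof.
move=> ij; have ji : j != i by rewrite eq_sym.
have b := act_braid A ij.
have p1 := act_par (A := A) ij.
have p2 := act_par (A := A) ji.
have p3 := act_par (A := act A i) ij; rewrite actK in p3.
have p4 := act_par (A := act A j) ji; rewrite actK in p4.
have p5 := act_par (A := act A i) ji; rewrite actK in p5.
have p6 := act_par (A := act (act A i) j) ji; rewrite !actK in p6.
have l1 := len_act A i.
have l2 := len_act A j.
have l3 := len_act (act A i) j.
have l4 := len_act (act A j) i.
have l5 := len_act (act (act A i) j) i.
have := len_act (act (act A j) i) j.
rewrite /desc -b in p1 p2 p3 p4 p5 p6 *.
move: (len A) (len (act A i)) (len (act A j)) p1 p2 p3 p4 p5 p6 l1 l2 l3 l4 l5 => a ai aj.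
move: (len (act (act A i) j)) (len (act (act A j) i)) => aij aji.
move: (len _) => m p1 p2 p3 p4 p5 p6 l1 l2 l3 l4 l5 l6.
split; lia.
Qed.

Section Matsumoto.
Variables (X : Type) (R : 'I_3 -> X -> X) (x0 : X).
Hypothesis R_braid : forall i j x, i != j -> R i (R j (R i x)) = R j (R i (R j x)).

Fixpoint descend (n : nat) (A : alcove) : X :=
  if n is n'.+1 then
    if [pick i | desc A i] is Some i then R i (descend n' (act A i)) else x0
  else x0.

(** The product of the operators [R] along the descending gallery that takes the first
available descent at each step. *)
Definition gallery_fold A := descend (len A) A.

(** Matsumoto's theorem: the choice of the descent does not matter.  When [i] and [j] are
both descents of [A], the two halves of the star of their common vertex lead down to the same
alcove, and the braid relation identifies the two products. *)
Lemma gallery_fold_desc A i : desc A i -> gallery_fold A = R i (gallery_fold (act A i)).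
Proof.
move: {2}(len A) (leqnn (len A)) => n; elim: n A i => [|n IHn] A i lA di.
  by move: di lA; rewrite /desc; case: (len A).
have lenP k : desc A k -> len A = (len (act A k)).+1.
  by rewrite /desc; have := len_act A k; lia.
have [j dj ->] : exists2 j, desc A j & gallery_fold A = R j (gallery_fold (act A j)).
  rewrite /gallery_fold (lenP i di) /=; case: pickP => [j dj|/(_ i)]; last by rewrite di.
  by exists j => //; rewrite (_ : len (act A i) = len (act A j)) //;
    have := lenP i di; have := lenP j dj; lia.
have [<-//|ij] := eqVneq i j.
have [s1 s2 s3 s4] := desc_star A ij.
rewrite di dj in s1 s2 s4; rewrite s4 // in s3.
have IH B k : (len B <= n)%N -> desc B k -> gallery_fold B = R k (gallery_fold (act B k)).
  exact: IHn.
have li := lenP i di; have lj := lenP j dj.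
have lij : (len (act (act A i) j) < len (act A i))%N by apply: s4.
have lji : (len (act (act A j) i) < len (act A j))%N by rewrite -/(desc _ _) s3.
(* Descend along both halves of the star. *)
rewrite (IH _ i _ s3) ?(IH _ j _ (s4 _)) //; try lia.
rewrite (IH _ j _ s1) ?(IH _ i _ s2) //; try lia.
by rewrite R_braid 1?eq_sym // act_braid // eq_sym.
Qed.

End Matsumoto.

(** * The Coxeter group acts simply transitively on alcoves *)

(** The inverse of the orbit map of the fundamental alcove.  Matsumoto's theorem, applied to
right multiplications in W itself, makes it equivariant; this proves that W acts freely. *)
Definition W_of_alc : alcove -> W := gallery_fold (fun i w => w * s_ i)%g 1%g.

Lemma expr_cat r1 r2 : expr (r1 ++ r2) = (expr r1 * expr r2)%g.
Proof. by rewrite /expr big_cat. Qed.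

Lemma expr_rcons r i : expr (rcons r i) = (expr r * s_ i)%g.
Proof. by rewrite -cats1 expr_cat /expr big_seq1. Qed.

Lemma s_sq i : (s_ i * s_ i)%g = 1%g.
Proof. by rewrite /s_ [LHS]W_pi_mul; apply/W_piP; apply: CoxSquare. Qed.

Lemma s_mulK i : involutive (fun w : W => w * s_ i)%g.
Proof. by move=> w; rewrite -mulgA s_sq mulg1. Qed.

Lemma s_V i : (s_ i)^-1%g = s_ i.
Proof. by apply: (mulgI (s_ i)); rewrite mulgV s_sq. Qed.

Lemma s_braid i j : i != j -> (s_ i * s_ j * s_ i = s_ j * s_ i * s_ j)%g.
Proof.
move=> ij; have e : (s_ i * s_ j * s_ i * s_ j * s_ i * s_ j = 1)%g.
  have := exprE [:: i; j; i; j; i; j].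
  rewrite (iffRL (W_piP _ _) (CoxBraid ij)) /expr !big_cons big_nil => e.
  by rewrite mulg1 !mulgA in e.
apply: (mulIg (s_ j)); apply: (mulIg (s_ i)); apply: (mulIg (s_ j)).
by rewrite e !s_mulK s_sq.
Qed.

Lemma s_mulA3 w i j : i != j ->
  (w * s_ i * s_ j * s_ i = w * s_ j * s_ i * s_ j)%g.
Proof. by move=> ij; rewrite -2!mulgA (mulgA (s_ i)) s_braid // !mulgA. Qed.

Lemma W_of_alc_act A i : W_of_alc (act A i) = (W_of_alc A * s_ i)%g.
Proof.
have R_braid i' j (w : W) : i' != j ->
    (w * s_ i' * s_ j * s_ i' = w * s_ j * s_ i' * s_ j)%g by exact: s_mulA3.
have H := gallery_fold_desc (R := fun i w => (w * s_ i)%g) (1%g : W) R_braid.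
have [d|nd] := boolP (desc A i); first by rewrite /W_of_alc (H A i) // s_mulK.
rewrite /W_of_alc (H (act A i) i) ?actK // /desc actK.
by have := len_act A i; move: nd; rewrite /desc; lia.
Qed.

Definition acts (A : alcove) (r : seq 'I_3) : alcove := foldl act A r.

(** The generators act on alcoves through involutions satisfying the braid relations, so the
action is well defined on W. *)
Lemma acts_cox r1 r2 : cox_rel r1 r2 -> acts^~ r1 =1 acts^~ r2.
Proof.
elim=> {r1 r2} [r|r1 r2 _ h|r2 r1 r3 _ + _|r1 r1' r2 r2' _ h1 _ h2|i|i j ij] A //=.
- by move=> h1 h2; rewrite h1.
- by rewrite /acts !foldl_cat -!/(acts _ _) h1 h2.
- exact: actK.
- by rewrite (act_braid _ ij) !actK.
Qed.

(** The alcove of a group element: the image of the fundamental alcove under it. *)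
Definition alc (w : W) : alcove := acts alcove0 (repr w).

Lemma alc_expr r : alc (expr r) = acts alcove0 r.
Proof. by apply: acts_cox; apply/W_piP; rewrite reprK exprE. Qed.

Lemma W_ind (P : W -> Prop) : (forall r, P (expr r)) -> forall w, P w.
Proof. by move=> h w; rewrite -[w]reprK -exprE. Qed.

Lemma alc_mul w r : alc (w * expr r)%g = acts (alc w) r.
Proof. by elim/W_ind: w => r'; rewrite -expr_cat !alc_expr /acts foldl_cat. Qed.

Lemma alc_s w i : alc (w * s_ i)%g = act (alc w) i.
Proof. by have := alc_mul w [:: i]; rewrite /expr big_seq1. Qed.

Lemma alc1 : alc 1%g = alcove0.
Proof. by have := alc_expr [::]; rewrite /expr big_nil. Qed.

Lemma alcK : cancel alc W_of_alc.
Proof.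
elim/W_ind; elim/last_ind => [|r i IHr]; first by rewrite /expr big_nil alc1.
by rewrite expr_rcons alc_s W_of_alc_act IHr.
Qed.

Lemma alc_inj : injective alc. Proof. exact: can_inj alcK. Qed.

(** Walking down to the fundamental alcove takes as many steps as there are separating
hyperplanes. *)
Lemma alc_word A : exists2 r, size r = len A & acts alcove0 r = A.
Proof.
move: {2}(len A) (erefl (len A)) => n; elim: n A => [|n IHn] A lA.
  by exists [::]; rewrite ?lA ?(len0 lA).
have [|i di] := len_descent (A := A); first by rewrite lA.
have lA' : len (act A i) = n by have := len_act A i; move: di; lia.
have [r sr rA] := IHn _ lA'; exists (rcons r i); first by rewrite size_rcons sr lA' lA.
by rewrite /acts foldl_rcons -/(acts _ _) rA actK.
Qed.

Lemma len_acts r A : (len (acts A r) <= len A + size r)%N.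
Proof.
elim/last_ind: r => [|r i IHr]; first by rewrite addn0.
rewrite /acts foldl_rcons size_rcons -/(acts _ _).
by have := len_act (acts A r) i; lia.
Qed.

(** Each step changes the number of separating hyperplanes by one, so no word is shorter than
that number, and a descending gallery attains it. *)
Lemma ellE w : ell w = len (alc w).
Proof.
rewrite /ell; case: ex_minnP => n /asboolP[r [<- <-]] h; apply/eqP.
rewrite eqn_leq alc_expr (len_acts r alcove0) andbT.
have [r' sr' rA] := alc_word (acts alcove0 r); rewrite -sr'; apply: h; apply/asboolP.
by exists r'; split=> //; apply: alc_inj; rewrite !alc_expr.
Qed.

(** * The Bruhat order *)

Lemma ell_s w i : ell (w * s_ i)%g = (ell w).+1 \/ ell w = (ell (w * s_ i)%g).+1.
Proof. by rewrite !ellE alc_s; apply: len_act. Qed.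

Lemma refl_acts r k A u : refl r k (acts A u) = acts (refl r k A) u.
Proof. by elim: u A => //= i u IHu A; rewrite /acts /= -!/(acts _ _) IHu refl_act. Qed.

(** To multiply y by x s_i x^-1, walk to the alcove of y x, cross its wall of type i, and walk
back along x.  The crossing is a reflection, and reflections commute with the way back. *)
Lemma alc_reflection t y : reflection t -> exists r k, alc (y * t)%g = refl r k (alc y).
Proof.
case=> x [i ->]; have [r [k E]] := act_refl (alc (y * x)%g) i; exists r, k.
elim/W_ind: x E => x E; have xV : ((expr x)^-1 = expr (rev x))%g.
  by rewrite !exprE; apply: W_pi_inv.
rewrite xV !mulgA alc_mul alc_s E -refl_acts -alc_mul.
by rewrite -xV mulgK.
Qed.

Lemma ell_exchange t y i : reflection t -> (ell y < ell (y * t)%g)%N ->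
  t <> s_ i -> (ell (y * s_ i)%g < ell (y * t * s_ i)%g)%N.
Proof.
move=> rt; have [r [k E]] := alc_reflection y rt.
rewrite !ellE !alc_s E -refl_act => h ne; apply: refl_exchange => //.
by rewrite -E -alc_s => /alc_inj /mulgI.
Qed.

Lemma bruhat_trans x y z : bruhat_le x y -> bruhat_le y z -> bruhat_le x z.
Proof.
move=> xy yz; elim: yz xy => // {}z {}y t _ IH rt lt /IH h.
exact: BruhatStep h rt lt.
Qed.

Lemma reflection_s i : reflection (s_ i).
Proof. by exists 1%g, i; rewrite mul1g invg1 mulg1. Qed.

Lemma reflection_conj t i : reflection t -> reflection (s_ i * t * s_ i)%g.
Proof.
by case=> x [j ->]; exists (s_ i * x)%g, j; rewrite invgM s_V !mulgA.
Qed.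

Lemma bruhat_s w i : (ell w < ell (w * s_ i)%g)%N -> bruhat_le w (w * s_ i)%g.
Proof. by apply: BruhatStep; [apply: BruhatRefl|apply: reflection_s]. Qed.

Lemma bruhat_ell x y : bruhat_le x y -> x = y \/ (ell x < ell y)%N.
Proof.
elim=> [|{}x {}y t _ [->|h] _ h']; [by left|by right|right].
exact: ltn_trans h h'.
Qed.

Lemma bruhat_exchange y t i : reflection t -> (ell y < ell (y * t)%g)%N ->
  t <> s_ i -> bruhat_le (y * s_ i)%g (y * t * s_ i)%g.
Proof.
move=> rt lt ti; have := ell_exchange rt lt ti.
rewrite (_ : y * t * s_ i = y * s_ i * (s_ i * t * s_ i))%g.
  by apply: BruhatStep; [apply: BruhatRefl|apply: reflection_conj].
by rewrite !mulgA s_mulK.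
Qed.

(** Right multiplication by [s_ i] transforms a chain of reflections into a chain of
conjugate reflections.  Lengths still increase by [bruhat_exchange], except at a step by the
reflection [s_ i] itself; but after such a step the chain is already above x s_i. *)
Lemma bruhat_lift x w i : bruhat_le x w -> (ell w < ell (w * s_ i)%g)%N ->
  bruhat_le (x * s_ i)%g (w * s_ i)%g.
Proof.
move=> xw lw; have : bruhat_le (x * s_ i)%g w \/ bruhat_le (x * s_ i)%g (w * s_ i)%g.
  elim: xw {lw} => [z|z y t _ IH rt lt]; first by right; apply: BruhatRefl.
  case: IH => IH; first by left; apply: BruhatStep.
  have [ti|ti] := pselect (t = s_ i); first by left; rewrite ti.
  by right; apply: bruhat_trans IH (bruhat_exchange rt lt ti).
by case=> // h; apply: bruhat_trans h (bruhat_s lw).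
Qed.

(** The lifting property: when [w] < [w s_i], the lower interval of [w s_i] is the union
of the lower interval of [w] and of its image under right multiplication by [s_ i]. *)
Lemma bruhat_mul_s x w i : (ell w < ell (w * s_ i)%g)%N ->
  bruhat_le x (w * s_ i)%g <-> bruhat_le x w \/ bruhat_le (x * s_ i)%g w.
Proof.
move=> lw; split=> [|[h|h]]; last 2 first.
- exact: bruhat_trans h (bruhat_s lw).
- by rewrite -[x](s_mulK i); apply: bruhat_lift.
(* The union on the right-hand side is closed downwards. *)
pose low z := bruhat_le z w \/ bruhat_le (z * s_ i)%g w.
have stepP y t : reflection t -> (ell y < ell (y * t)%g)%N -> low (y * t)%g -> low y.
  move=> rt lt [h|h].
    by left; apply: bruhat_trans h; apply: BruhatStep (BruhatRefl _) rt lt.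
  have [ti|ti] := pselect (t = s_ i); first by left; move: h; rewrite ti s_mulK.
  by right; apply: bruhat_trans (bruhat_exchange rt lt ti) h.
have down x' y : bruhat_le x' y -> low y -> low x'.
  by elim=> // {}x' {}y t _ IH rt lt /(stepP _ _ rt lt)/IH.
by move=> /down; apply; right; rewrite s_mulK; apply: BruhatRefl.
Qed.

Lemma ell0 w : ell w = 0%N -> w = 1%g.
Proof. by rewrite ellE => /len0 h; apply: alc_inj; rewrite alc1. Qed.

Lemma ell1 : ell 1%g = 0%N. Proof. by rewrite ellE alc1. Qed.

Lemma bruhat_1 x : bruhat_le x 1%g <-> x = 1%g.
Proof.
split=> [/bruhat_ell[]//|->]; last exact: BruhatRefl.
by rewrite ell1.
Qed.

Lemma ell_descent w : (0 < ell w)%N -> exists i, (ell (w * s_ i)%g < ell w)%N.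
Proof. by rewrite ellE => /len_descent[i h]; exists i; rewrite !ellE alc_s. Qed.

Local Open Scope classical_set_scope.

(** Every element of length n + 1 is one of three neighbours of an element of length at
most n. *)
Lemma finite_ell n : finite_set [set w | (ell w <= n)%N].
Proof.
elim: n => [|n IHn].
  apply: sub_finite_set (finite_set1 1%g) => w /=.
  by rewrite leqn0 => /eqP/ell0.
pose E := [set w : W | (ell w <= n)%N].
have fE i : finite_set [set (w * s_ i)%g | w in E] by apply: finite_image.
have := fE gen2; have := fE gen1; have := fE gen0 => f0 f1 f2.
apply: (@sub_finite_set _ _ (E `|` ([set (w * s_ gen0)%g | w in E] `|`
   ([set (w * s_ gen1)%g | w in E] `|` [set (w * s_ gen2)%g | w in E])))); last first.
  by rewrite !finite_setU.
move=> w /=; rewrite leq_eqVlt ltnS => /orP[/eqP lw|]; last by left.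
right; have [|i lwi] := @ell_descent w; first by rewrite lw.
have {lwi} : E (w * s_ i)%g by rewrite /E /=; move: lwi; rewrite lw ltnS.
by elim/ord3_ind: i => h; [left|right; left|right; right];
  (eexists; [exact: h|exact: s_mulK]).
Qed.

(** * The regular representation and coefficients in the standard basis *)

Definition rdesc (w : W) (i : 'I_3) : bool := (ell (w * s_ i)%g < ell w)%N.

Lemma rdescE w i : rdesc w i = desc (alc w) i.
Proof. by rewrite /rdesc /desc !ellE alc_s. Qed.

Definition q : laurent := v^-1 - v.

(** The transpose, on functions on W, of right multiplication by [H_ i] in the standard
basis.  Being built from functions it satisfies the relations by direct computation, which
proves the linear independence of the standard basis. *)
Definition hecke_op (i : 'I_3) (f : W -> laurent) (w : W) : laurent :=
  f (w * s_ i)%g + (rdesc w i)%:R * (q * f w).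

Lemma rdesc_s w i : rdesc (w * s_ i)%g i = ~~ rdesc w i.
Proof. by rewrite /rdesc s_mulK; have := ell_s w i; lia. Qed.

(** On each pair {w, w s_i} this is the quadratic relation of a matrix of size 2. *)
Lemma hecke_op_quad i f w : hecke_op i (hecke_op i f) w = q * hecke_op i f w + f w.
Proof.
rewrite /hecke_op rdesc_s s_mulK.
by case: (rdesc w i) => /=; ring.
Qed.

(** On each coset of the dihedral group generated by [s_ i] and [s_ j] the relation depends
only on the descents around the star of a vertex, whose possible patterns are those allowed by
[desc_star]. *)
Lemma hecke_op_braid i j f : i != j ->
  hecke_op i (hecke_op j (hecke_op i f)) = hecke_op j (hecke_op i (hecke_op j f)).
Proof.
move=> ij; apply/funext => w; rewrite /hecke_op.
have [] := desc_star (alc w) ij; rewrite -!alc_s -!rdescE.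
have := rdesc_s w i; have := rdesc_s w j.
rewrite (s_mulA3 w ij) !s_mulK.
have := rdesc_s (w * s_ i)%g j; have := rdesc_s (w * s_ j)%g i.
move: (rdesc w i) (rdesc w j) (rdesc (w * s_ i)%g j) (rdesc (w * s_ j)%g i)
  => [] [] [] [] //= h1 h2 h3 h4; rewrite ?h1 ?h2 ?h3 ?h4 /= => -> -> //= _ h;
  rewrite ?h //; try (by have := h erefl); ring.
Qed.

Lemma hecke_op_sum (I : Type) (r : seq I) (c : I -> laurent) (F : I -> W -> laurent) i w :
  hecke_op i (fun w' => \sum_(k <- r) c k * F k w') w = \sum_(k <- r) c k * hecke_op i (F k) w.
Proof.
rewrite /hecke_op !mulr_sumr -big_split /=; apply: eq_bigr => k _; ring.
Qed.

Definition hecke_ops (r : seq 'I_3) (f : W -> laurent) := foldr hecke_op f r.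

Lemma hecke_ops_sum (I : Type) (r : seq I) (c : I -> laurent) (F : I -> W -> laurent) u w :
  hecke_ops u (fun w' => \sum_(k <- r) c k * F k w') w = \sum_(k <- r) c k * hecke_ops u (F k) w.
Proof.
elim: u w => //= i u IHu w; rewrite -hecke_op_sum; congr (hecke_op i _ w).
by apply/funext => w'; apply: IHu.
Qed.

(** The action of the free algebra on functions on W in which the generator [X_ i] acts as
[hecke_op i]. *)
Definition free_act (x : free_alg) (f : W -> laurent) (w : W) : laurent :=
  mmap idfun (fun k : {fmonom 'I_3} => hecke_ops k f w) x.

Lemma free_actB x y f w : free_act (x - y) f w = free_act x f w - free_act y f w.
Proof. exact: raddfB. Qed.

Lemma free_actD x y f w : free_act (x + y) f w = free_act x f w + free_act y f w.
Proof. exact: raddfD. Qed.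

Lemma free_act0 f w : free_act 0 f w = 0.
Proof. exact: raddf0. Qed.

Lemma free_actZ c x f w : free_act (c *: x) f w = c * free_act x f w.
Proof.
rewrite /free_act (mmapEw (msuppZ_le _ _)) mmapE mulr_sumr.
by apply: eq_bigr => k _; rewrite mcoeffZ mulrA.
Qed.

Lemma free_act1 f w : free_act 1 f w = f w.
Proof. by rewrite /free_act mmapU mul1r fm1. Qed.

Lemma free_actX i f w : free_act (X_ i) f w = hecke_op i f w.
Proof. by rewrite /free_act mmapU mul1r fmU. Qed.

Lemma free_actM x y f w : free_act (x * y) f w = free_act x (free_act y f) w.
Proof.
rewrite malgME /free_act raddf_sum [RHS]mmapE; apply: eq_bigr => k _.
rewrite raddf_sum [X in _ = _ * X]hecke_ops_sum mulr_sumr; apply: eq_bigr => l _.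
by rewrite /= mmapU fmM /hecke_ops foldr_cat mulrA.
Qed.

Lemma free_act_sum x (I : Type) (r : seq I) (c : I -> laurent) (F : I -> W -> laurent) w :
  free_act x (fun w' => \sum_(k <- r) c k * F k w') w = \sum_(k <- r) c k * free_act x (F k) w.
Proof.
under [RHS]eq_bigr do rewrite mulr_sumr.
rewrite [LHS]mmapE exchange_big /=; apply: eq_bigr => k _.
by rewrite hecke_ops_sum mulr_sumr; apply: eq_bigr => l _; rewrite mulrCA.
Qed.

Lemma free_act_ideal x : hecke_ideal x -> forall f w, free_act x f w = 0.
Proof.
elim=> {x} [i|i j ij||x y _ hx _ hy|a x b _ hx] f w.
- rewrite free_actB free_actD free_actZ free_act1 expr2 free_actM !free_actX.
  rewrite (_ : free_act (X_ i) f = hecke_op i f); last by apply/funext => ?; apply: free_actX.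
  by rewrite hecke_op_quad subrr.
- have E k g : free_act (X_ k) g = hecke_op k g by apply/funext => ?; apply: free_actX.
  apply: (eq_trans (free_actB _ _ _ _)).
  rewrite -[RHS](subrr (hecke_op i (hecke_op j (hecke_op i f)) w)).
  congr (_ - _).
    apply: (eq_trans (free_actM _ _ _ _)); rewrite E.
    by apply: (eq_trans (free_actM _ _ _ _)); rewrite 2!E.
  rewrite (hecke_op_braid _ ij).
  apply: (eq_trans (free_actM _ _ _ _)); rewrite E.
  by apply: (eq_trans (free_actM _ _ _ _)); rewrite 2!E.
- exact: free_act0.
- by rewrite free_actB hx hy subrr.
- rewrite 2!free_actM.
  have -> : free_act x (free_act b f) = fun w' => \sum_(k <- [::] : seq nat) 0 * f w'.
    by apply/funext => w'; rewrite big_nil hx.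
  by rewrite (free_act_sum _ _ (fun=> 0) (fun=> f)) big_nil.
Qed.

Local Open Scope quotient_scope.

Definition hact (h : hecke) (f : W -> laurent) (w : W) : laurent := free_act (repr h) f w.

Lemma hact_pi x f w : hact (\pi_hecke x) f w = free_act x f w.
Proof.
apply/eqP; rewrite -subr_eq0 -free_actB; apply/eqP/free_act_ideal.
by apply/hecke_piP; rewrite reprK.
Qed.

Lemma hact_is_additive f w : additive (fun h => hact h f w).
Proof.
elim/quotW=> x; elim/quotW=> y.
have -> : \pi_hecke x - \pi_hecke y = \pi_hecke (x - y) by rewrite !piE.
by rewrite !hact_pi free_actB.
Qed.

Lemma hactZ (c : laurent) (h : hecke) f w : hact (c *: h) f w = c * hact h f w.
Proof. by elim/quotW: h => x; rewrite [c *: _]hecke_pi_scale !hact_pi free_actZ. Qed.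

Lemma hactM h h' f w : hact (h * h') f w = hact h (hact h' f) w.
Proof.
elim/quotW: h => x; elim/quotW: h' => y.
rewrite [_ * _]hecke_pi_mul !hact_pi free_actM; congr (free_act x _ w).
by apply/funext => w'; rewrite hact_pi.
Qed.

Lemma hactH i f w : hact (H_ i) f w = hecke_op i f w.
Proof. by rewrite hact_pi free_actX. Qed.

Lemma hact1 f w : hact 1 f w = f w.
Proof. by rewrite (_ : 1 = \pi_hecke 1) // hact_pi free_act1. Qed.

Definition dirac (w x : W) : laurent := (x == w)%:R.

(** The coefficient of [std w] in [h]: the transpose action of [h] on the Dirac function of
[w], evaluated at 1. *)
Definition hcoef (w : W) (h : hecke) : laurent := hact h (dirac w) 1%g.

HB.instance Definition _ w := GRing.isAdditive.Build hecke laurent (hcoef w)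
  (hact_is_additive (dirac w) 1%g).

Lemma hcoefZ w (c : laurent) (h : hecke) : hcoef w (c *: h) = c * hcoef w h.
Proof. exact: hactZ. Qed.

Lemma hcoef1 w : hcoef w 1 = (w == 1%g)%:R.
Proof. by rewrite /hcoef hact1 /dirac eq_sym. Qed.

Lemma hcoef_mulH w h i :
  hcoef w (h * H_ i) = hcoef (w * s_ i)%g h + (rdesc w i)%:R * (q * hcoef w h).
Proof.
(* The operator sends a Dirac function to a combination of at most two of them. *)
have E : hecke_op i (dirac w) = fun x =>
    \sum_(p <- [:: (1, (w * s_ i)%g : W); ((rdesc w i)%:R * q, w)]) p.1 * dirac p.2 x.
  apply/funext => x; rewrite !big_cons big_nil /= addr0 mul1r -mulrA /hecke_op /dirac.
  rewrite (can2_eq (s_mulK i) (s_mulK i)).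
  by congr (_ + _); case: (eqVneq x w) => [->|_] //; rewrite !mulr0.
rewrite /hcoef hactM [X in hact h X](_ : _ = hecke_op i (dirac w)); last first.
  by apply/funext => x; apply: hactH.
by rewrite E [LHS]free_act_sum !big_cons big_nil /= addr0 mul1r -mulrA.
Qed.

Lemma H_sq i : H_ i * H_ i = (q *: H_ i : hecke) + 1.
Proof.
rewrite [LHS]hecke_pi_mul [q *: _]hecke_pi_scale [_ + 1]hecke_pi_add.
by apply/hecke_piP; rewrite -expr2; apply: HIdealQuad.
Qed.

Lemma pi_mul (x y : free_alg) : \pi_hecke x * \pi_hecke y = \pi_hecke (x * y) :> hecke.
Proof. exact: hecke_pi_mul. Qed.

Lemma H_braid i j : i != j -> H_ i * H_ j * H_ i = H_ j * H_ i * H_ j.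
Proof.
move=> ij.
have M k l : H_ k * H_ l * H_ k = \pi_hecke (X_ k * X_ l * X_ k).
  by rewrite [H_ k * H_ l]pi_mul [LHS]pi_mul.
apply: (eq_trans (M i j)); apply: (eq_trans _ (esym (M j i))).
by apply/hecke_piP; apply: HIdealBraid.
Qed.

(** * The standard basis *)

Definition hword (r : seq 'I_3) : hecke := \prod_(i <- r) H_ i.

Lemma hword_rcons r i : hword (rcons r i) = hword r * H_ i.
Proof. by rewrite /hword -cats1 big_cat big_seq1. Qed.

Lemma reduced_rcons r i w : reduced (rcons r i) w ->
  reduced r (w * s_ i)%g /\ (ell (w * s_ i)%g < ell w)%N.
Proof.
rewrite /reduced expr_rcons size_rcons => -[<- sr]; rewrite s_mulK.
have le : (ell (expr r) <= size r)%N by have := len_acts r alcove0; rewrite -alc_expr -ellE.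
by split; [split=> //|]; case: (ell_s (expr r) i) => e; rewrite e in sr *; lia.
Qed.

Lemma exists_reduced w : exists r, reduced r w.
Proof.
have [r sr rA] := alc_word (alc w); exists r; split; last by rewrite ellE.
by apply: alc_inj; rewrite alc_expr.
Qed.

Lemma mulr_braid (R : pzRingType) (h x y : R) :
  x * y * x = y * x * y -> h * x * y * x = h * y * x * y.
Proof. by move=> e; rewrite -!mulrA mulrA in e *; rewrite e !mulrA. Qed.

(** Matsumoto's theorem for the right multiplications by the [H_ i]: the product along
a reduced word depends only on the element of W. *)
Lemma hword_reduced r w : reduced r w ->
  hword r = gallery_fold (fun i h => h * H_ i) 1 (alc w).
Proof.
have B i j (h : hecke) : i != j -> h * H_ i * H_ j * H_ i = h * H_ j * H_ i * H_ j.
  by move=> /H_braid; apply: mulr_braid.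
elim/last_ind: r w => [|r i IHr] w.
  by case=> <- _; rewrite /hword /expr !big_nil alc1.
move=> /reduced_rcons[rw lt]; rewrite hword_rcons (IHr _ rw) alc_s.
by rewrite (gallery_fold_desc 1 B (i := i) (A := alc w)) // -rdescE.
Qed.

Lemma std_reduced r w : reduced r w -> std w = hword r.
Proof.
move=> rw; rewrite (hword_reduced rw); apply: hword_reduced.
exact: (xgetPex [::] (P := fun r => reduced r w) (ex_intro _ r rw)).
Qed.

Lemma std1 : std 1%g = 1.
Proof.
by rewrite (@std_reduced [::]) /hword ?big_nil //; split; rewrite /expr ?big_nil ?ell1.
Qed.

Lemma std_s w i : (ell w < ell (w * s_ i)%g)%N -> std (w * s_ i)%g = std w * H_ i.
Proof.
move=> lt; have [r rw] := exists_reduced w; rewrite (std_reduced rw) -hword_rcons.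
apply: std_reduced; case: rw => rw sr; split; first by rewrite expr_rcons rw.
by rewrite size_rcons sr; have := ell_s w i; lia.
Qed.

Lemma hcoef_std w z : hcoef z (std w) = (z == w)%:R.
Proof.
have [n] := ubnP (ell w); elim: n w z => // n IHn w z; rewrite ltnS => lw.
have [/ell0 ->|/ell_descent[i lt]] := posnP (ell w); first by rewrite std1 hcoef1.
rewrite -[w](s_mulK i) std_s ?s_mulK // hcoef_mulH !IHn ?(leq_trans lt) //.
rewrite (can_eq (s_mulK i)).
case: (eqVneq z (w * s_ i)%g) => [->|_]; last by rewrite !mulr0 addr0.
by rewrite rdesc_s /rdesc lt mul0r addr0.
Qed.

Definition lincomb (s : seq (laurent * W)) : hecke := \sum_(p <- s) p.1 *: std p.2.

Lemma std_mulH w i : exists s, std w * H_ i = lincomb s.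
Proof.
have [lt|lt] := boolP (rdesc w i); last first.
  exists [:: (1, (w * s_ i)%g : W)]; rewrite /lincomb big_seq1 scale1r std_s //.
  by have := ell_s w i; move: lt; rewrite /rdesc; lia.
exists [:: (q, w); (1, (w * s_ i)%g : W)]; rewrite /lincomb big_cons big_seq1 scale1r /=.
have e : std w = std (w * s_ i)%g * H_ i by rewrite -std_s s_mulK.
by rewrite {1}e -mulrA H_sq mulrDr mulr1 -scalerAr -e.
Qed.

Lemma pi_monom (c : laurent) (k : {fmonom 'I_3}) :
  \pi_hecke (<< c *g k >> : free_alg) = c *: hword k.
Proof.
have -> : (<< c *g k >> : free_alg) = c *: (<< k >> : free_alg).
  by rewrite -mul_malgC malgM_def fgmulUU mul1m mulr1.
rewrite -[LHS]hecke_pi_scale; congr (c *: _); case: k => r.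
elim: r => [|i r IHr]; first by rewrite /hword big_nil -fmoneE.
rewrite /hword big_cons -[X in _ = _ * X]IHr [RHS]pi_mul; congr (\pi_hecke _).
by rewrite malgM_def fgmulUU mulr1; congr (<< _ *g _ >>); apply/val_inj; rewrite /= fmM fmU.
Qed.

(** The span of the standard basis contains 1 and is stable under right multiplication by
the generators, by the quadratic relation. *)
Lemma hecke_span h : exists s, h = lincomb s.
Proof.
have lD h1 h2 : (exists s, h1 = lincomb s) -> (exists s, h2 = lincomb s) ->
  exists s, h1 + h2 = lincomb s.
  by move=> [s1 ->] [s2 ->]; exists (s1 ++ s2); rewrite /lincomb big_cat.
have lZ c h1 : (exists s, h1 = lincomb s) -> exists s, c *: h1 = lincomb s.
  move=> [s ->]; exists [seq (c * p.1, p.2) | p <- s].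
  by rewrite /lincomb big_map scaler_sumr; apply: eq_bigr => p _; rewrite scalerA.
have lS (I : Type) (r : seq I) (F : I -> hecke) :
    (forall k, exists s, F k = lincomb s) -> exists s, \sum_(k <- r) F k = lincomb s.
  move=> hF; elim: r => [|k r IHr]; rewrite ?big_nil ?big_cons; last exact: lD.
  by exists [::]; rewrite /lincomb big_nil.
have lw r : exists s, hword r = lincomb s.
  elim/last_ind: r => [|r i [s hs]].
    by exists [:: (1, 1%g : W)]; rewrite /lincomb big_seq1 scale1r std1 /hword big_nil.
  rewrite hword_rcons hs mulr_suml; apply: lS => p.
  by rewrite -scalerAl; apply: lZ; apply: std_mulH.
elim/quotW: h => x; rewrite [x]monalgE.
have piS (r : seq {fmonom 'I_3}) (F : _ -> free_alg) :
    \pi_hecke (\sum_(k <- r) F k) = \sum_(k <- r) \pi_hecke (F k).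
  elim: r => [|k r IHr]; first by rewrite !big_nil hecke_pi0.
  by rewrite !big_cons -IHr hecke_pi_add.
rewrite piS; apply: lS => k.
by rewrite pi_monom; apply: lZ.
Qed.

(** * Laurent polynomials and their bar involution *)

(** Evaluation at v is [poly_v], and evaluation at v^-1 serves for the bar involution. *)
Definition poly_at (y : laurent) (p : {poly int}) : laurent := (map_poly intr p).[y].

Lemma poly_atD y : {morph poly_at y : a b / a + b}.
Proof. by move=> a b; rewrite /poly_at rmorphD hornerD. Qed.
Lemma poly_atM y : {morph poly_at y : a b / a * b}.
Proof. by move=> a b; rewrite /poly_at rmorphM hornerM. Qed.
Lemma poly_at1 y : poly_at y 1 = 1.
Proof. by rewrite /poly_at rmorph1 hornerC. Qed.
Lemma poly_atB y : {morph poly_at y : a b / a - b}.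
Proof. by move=> a b; rewrite /poly_at rmorphB hornerD hornerN. Qed.
Lemma poly_atX y : poly_at y 'X = y.
Proof. by rewrite /poly_at map_polyX hornerX. Qed.
Lemma poly_atXn y n : poly_at y 'X^n = y ^+ n.
Proof. by rewrite /poly_at map_polyXn hornerXn. Qed.
Lemma poly_atC y c : poly_at y c%:P = c%:~R.
Proof. by rewrite /poly_at map_polyC hornerC. Qed.

Lemma poly_vE p : poly_v p = poly_at v p. Proof. by []. Qed.
Lemma poly_v0 : poly_v 0 = 0.
Proof. by rewrite /poly_v rmorph0 horner0. Qed.

Lemma laurent_valD a b : laurent_val (a + b) = laurent_val a + laurent_val b.
Proof. exact: (rmorphD (val : laurent -> _)). Qed.
Lemma laurent_valM a b : laurent_val (a * b) = laurent_val a * laurent_val b.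
Proof. exact: (rmorphM (val : laurent -> _)). Qed.
Lemma laurent_valXn a n : laurent_val (a ^+ n) = laurent_val a ^+ n.
Proof. exact: (rmorphXn (val : laurent -> _)). Qed.
Lemma laurent_val_int (c : int) : laurent_val c%:~R = c%:~R.
Proof. exact: (rmorph_int (val : laurent -> _)). Qed.

Lemma laurent_val_poly p : laurent_val (poly_v p) = tofrac p.
Proof.
elim/poly_ind: p => [|p c IHp]; first by rewrite poly_v0 tofrac0.
rewrite poly_vE poly_atD poly_atM poly_atX poly_atC tofracD tofracM -IHp.
rewrite laurent_valD laurent_valM laurent_val_int; congr (_ + _).
by rewrite -[in RHS](intz c) rmorph_int; apply/esym; apply: (rmorph_int (@tofrac _)).
Qed.

Lemma poly_v_inj : injective poly_v.
Proof.
move=> a b /(congr1 laurent_val); rewrite !laurent_val_poly => /eqP.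
by rewrite tofrac_eq => /eqP.
Qed.

Lemma laurentP (x : laurent) : exists pn : {poly int} * nat,
  x = poly_v pn.1 * v^-1 ^+ pn.2.
Proof.
have /asboolP[p [n e]] := laurent_valP x; exists (p, n).
apply: (val_inj : injective laurent_val).
rewrite laurent_valM laurent_valXn laurent_val_poly e.
congr (_ * _); rewrite -exprVn; congr (_ ^+ n).
apply: (mulfI (x := tofrac 'X)); first by rewrite tofrac_eq0 polyX_eq0.
rewrite mulfV ?tofrac_eq0 ?polyX_eq0 //.
by rewrite -[LHS](congr1 laurent_val (mulrV v_unit)).
Qed.

Lemma mulvV : v * v^-1 = 1. Proof. exact: mulrV v_unit. Qed.
Lemma exp_mulvV n : v ^+ n * v^-1 ^+ n = 1.
Proof. by rewrite -exprMn mulvV expr1n. Qed.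

(** Two fractions p / v^m and p' / v^n that agree in v also agree after v is replaced by
v^-1: clear denominators and use that v is transcendental. *)
Lemma poly_at_clear (a b : {poly int}) m n :
  poly_v a * v^-1 ^+ m = poly_v b * v^-1 ^+ n ->
  poly_at v^-1 a * v ^+ m = poly_at v^-1 b * v ^+ n.
Proof.
move=> e; have : a * 'X^n = b * 'X^m.
  apply: poly_v_inj; rewrite !poly_vE !poly_atM !poly_atXn.
  have := congr1 (fun x => x * v ^+ m * v ^+ n) e => /=.
  rewrite !poly_vE -(mulrA _ (v^-1 ^+ m)) (mulrC (v^-1 ^+ m)) exp_mulvV mulr1 => ->.
  by rewrite -[LHS]mulrA [v ^+ m * _]mulrC -!mulrA (mulrA (v^-1 ^+ n)) (mulrC (v^-1 ^+ n))
    exp_mulvV mul1r.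
move/(congr1 (poly_at v^-1)); rewrite !poly_atM !poly_atXn => e'.
have := congr1 (fun x => x * v ^+ m * v ^+ n) e' => /=.
rewrite -!mulrA ![v^-1 ^+ n * _]mulrC -!mulrA exp_mulvV mulr1 => ->.
by rewrite (mulrA (v^-1 ^+ m)) (mulrC (v^-1 ^+ m)) exp_mulvV mul1r.
Qed.

(** The involution v |-> v^-1. *)
Definition laurent_bar (x : laurent) : laurent :=
  let: pn := projT1 (cid (laurentP x)) in poly_at v^-1 pn.1 * v ^+ pn.2.

Lemma laurent_barE (p : {poly int}) n : laurent_bar (poly_v p * v^-1 ^+ n) =
  poly_at v^-1 p * v ^+ n.
Proof. by rewrite /laurent_bar; case: cid => -[p' n'] /= /poly_at_clear. Qed.

Lemma laurent_bar_is_additive : additive laurent_bar.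
Proof.
move=> x y; have [[p m] /= ->] := laurentP x; have [[p' n] /= ->] := laurentP y.
have -> : poly_v p * v^-1 ^+ m - poly_v p' * v^-1 ^+ n =
          poly_v (p * 'X^n - p' * 'X^m) * v^-1 ^+ (m + n).
  rewrite !poly_vE poly_atB !poly_atM !poly_atXn mulrBl exprD.
  by have e1 := exp_mulvV m; have e2 := exp_mulvV n; congr (_ - _); ring: e1 e2.
rewrite !laurent_barE poly_atB !poly_atM !poly_atXn mulrBl exprD.
have e k : v^-1 ^+ k * v ^+ k = 1 by rewrite mulrC exp_mulvV.
by congr (_ - _); ring: (e m) (e n).
Qed.

Lemma laurent_bar_is_multiplicative : multiplicative laurent_bar.
Proof.
split=> [x y|]; last first.
  by have := laurent_barE 1 0; rewrite poly_vE !poly_at1 !mulr1.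
have [[p m] /= ->] := laurentP x; have [[p' n] /= ->] := laurentP y.
have -> : poly_v p * v^-1 ^+ m * (poly_v p' * v^-1 ^+ n) =
          poly_v (p * p') * v^-1 ^+ (m + n).
  by rewrite !poly_vE poly_atM exprD; ring.
by rewrite !laurent_barE poly_atM exprD; ring.
Qed.

HB.instance Definition _ := GRing.isAdditive.Build laurent laurent laurent_bar
  laurent_bar_is_additive.
HB.instance Definition _ := GRing.isMultiplicative.Build laurent laurent laurent_bar
  laurent_bar_is_multiplicative.

Lemma laurent_bar_poly p : laurent_bar (poly_v p) = poly_at v^-1 p.
Proof. by have := laurent_barE p 0; rewrite !expr0 !mulr1. Qed.

Lemma laurent_bar_v : laurent_bar v = v^-1.
Proof. by rewrite -{1}(poly_atX v) laurent_bar_poly poly_atX. Qed.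

Lemma laurent_bar_vV : laurent_bar v^-1 = v.
Proof. by have := laurent_barE 1 1; rewrite poly_vE !poly_at1 !expr1 !mul1r. Qed.

Lemma laurent_bar_q : laurent_bar q = - q.
Proof. by rewrite /q rmorphB /= laurent_bar_v laurent_bar_vV opprB. Qed.

(** The reversed polynomial: v^n p(v^-1) is a polynomial in v of degree at most n. *)
Lemma poly_at_reverse (p : {poly int}) :
  exists n (r : {poly int}), (size r <= n.+1)%N /\ poly_at v^-1 p * v ^+ n = poly_v r.
Proof.
elim/poly_ind: p => [|p c [n [r [sr e]]]].
  by exists 0, 0%R; rewrite size_poly0 poly_v0 /poly_at rmorph0 horner0 mul0r.
exists n.+1, (r + c *: 'X^(n.+1)); split.
  rewrite (leq_trans (size_polyD _ _)) // geq_max (leq_trans sr) //=.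
  by rewrite (leq_trans (size_scale_leq _ _)) // size_polyXn.
rewrite poly_atD poly_atM poly_atX poly_atC poly_vE poly_atD -mul_polyC poly_atM poly_atC
  poly_atXn.
rewrite mulrDl -poly_vE -e exprSr; congr (_ + _).
by have e1 := mulvV; ring: e1.
Qed.

(** A Laurent polynomial with only positive powers of v is carried by the involution to one
with only negative powers, hence is not invariant unless it is zero.  In terms of polynomials,
v^(n+2) p would be the reversal of p, of degree at most n. *)
Lemma bar_invariant_vpoly (p : {poly int}) : laurent_bar (v * poly_v p) = v * poly_v p -> p = 0.
Proof.
rewrite rmorphM /= laurent_bar_v laurent_bar_poly => e; apply/eqP; apply: contraT => p0.
have [n [r [sr er]]] := poly_at_reverse p.
have : 'X^(n.+2) * p = r.
  apply: poly_v_inj; rewrite -er poly_vE poly_atM poly_atXn -poly_vE.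
  rewrite exprSr exprSr -!mulrA -e (mulrA v) mulvV mul1r; exact: mulrC.
move=> er'; move: sr; rewrite -er' mulrC size_Mmonic ?monicXn // size_polyXn.
by have := p0; rewrite -size_poly_gt0; lia.
Qed.

(** * The bar involution of the Hecke algebra *)

Lemma scalar_comm (c : laurent) (h : hecke) : GRing.comm (c%:A : hecke) h.
Proof. by rewrite /GRing.comm mulr_algl mulr_algr. Qed.

(** The inverse of [H_ i]; by the quadratic relation it is H_i - (v^-1 - v). *)
Definition Hinv (i : 'I_3) : hecke := H_ i - q%:A.

Lemma H_mulV i : H_ i * Hinv i = 1.
Proof. by rewrite /Hinv mulrBr H_sq mulr_algr addrAC subrr add0r. Qed.

Lemma H_Vmul i : Hinv i * H_ i = 1.
Proof. by rewrite /Hinv mulrBl H_sq mulr_algl addrAC subrr add0r. Qed.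

Lemma H_unit i : H_ i \is a GRing.unit.
Proof. by apply/unitrP; exists (Hinv i); rewrite H_mulV H_Vmul. Qed.

Lemma H_invE i : (H_ i)^-1 = Hinv i.
Proof. by apply: (mulrI (H_unit i)); rewrite H_mulV mulrV ?H_unit. Qed.

Lemma Hinv_sq i : Hinv i * Hinv i = (- q *: Hinv i : hecke) + 1.
Proof.
by rewrite {1}/Hinv mulrBl H_mulV mulr_algl addrC scaleNr.
Qed.

Lemma mulr_braid_inv (R : unitRingType) (x y : R) :
  x \is a GRing.unit -> y \is a GRing.unit -> x * y * x = y * x * y ->
  x^-1 * y^-1 * x^-1 = y^-1 * x^-1 * y^-1.
Proof.
move=> ux uy /(congr1 GRing.inv); rewrite !invrM ?unitrMl //.
by rewrite !mulrA.
Qed.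

Lemma Hinv_braid i j : i != j -> Hinv i * Hinv j * Hinv i = Hinv j * Hinv i * Hinv j.
Proof.
move=> ij; rewrite -!H_invE.
exact: (mulr_braid_inv (H_unit i) (H_unit j) (H_braid ij)).
Qed.

Definition Hinv_word (k : {fmonom 'I_3}) : hecke := \prod_(i <- (k : seq 'I_3)) Hinv i.

Lemma Hinv_word_is_mmorphism : mmorphism Hinv_word.
Proof.
by split=> [k l|]; rewrite /Hinv_word (fm1, fmM) ?big_cat ?big_nil.
Qed.

HB.instance Definition _ := isMultiplicative.Build _ _ Hinv_word Hinv_word_is_mmorphism.

Definition bar_scalar (c : laurent) : hecke := (laurent_bar c)%:A.
Lemma bar_scalar_is_additive : additive bar_scalar.
Proof. by move=> a b; rewrite /bar_scalar rmorphB scalerBl. Qed.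
Lemma bar_scalar_is_multiplicative : multiplicative bar_scalar.
Proof.
by split=> [a b|]; rewrite /bar_scalar ?rmorph1 ?scale1r // rmorphM mulr_algl scalerA.
Qed.
HB.instance Definition _ := GRing.isAdditive.Build laurent hecke bar_scalar
  bar_scalar_is_additive.
HB.instance Definition _ := GRing.isMultiplicative.Build laurent hecke bar_scalar
  bar_scalar_is_multiplicative.

(** The semilinear homomorphism from the free algebra with [X_ i] |-> [Hinv i].  The inverses
satisfy the braid relation, and the quadratic relation with v and v^-1 exchanged, so it factors
through the Hecke algebra. *)
Definition free_bar (x : free_alg) : hecke := mmap bar_scalar Hinv_word x.

Lemma free_barB x y : free_bar (x - y) = free_bar x - free_bar y.
Proof. exact: raddfB. Qed.
Lemma free_barD x y : free_bar (x + y) = free_bar x + free_bar y.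
Proof. exact: raddfD. Qed.
Lemma free_bar_mult : multiplicative (mmap bar_scalar Hinv_word : free_alg -> hecke).
Proof. by apply: commr_mmap_is_multiplicative => g m m'; apply: scalar_comm. Qed.
Lemma free_barM x y : free_bar (x * y) = free_bar x * free_bar y.
Proof. by have [h _] := free_bar_mult; apply: h. Qed.
Lemma free_bar1 : free_bar 1 = 1.
Proof. by have [_ h] := free_bar_mult; apply: h. Qed.
Lemma free_barZ c x : free_bar (c *: x) = laurent_bar c *: free_bar x.
Proof. by rewrite /free_bar mmapZ /= /bar_scalar mulr_algl. Qed.
Lemma free_barX i : free_bar (X_ i) = Hinv i.
Proof. by rewrite /free_bar mmapU /= /bar_scalar rmorph1 scale1r mul1r /Hinv_word fmU big_seq1.
  Qed.

Lemma free_bar_ideal x : hecke_ideal x -> free_bar x = 0.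
Proof.
elim=> {x} [i|i j ij||x y _ hx _ hy|a x b _ hx].
- rewrite free_barB free_barD free_barZ free_bar1 expr2 free_barM !free_barX.
  by rewrite laurent_bar_q Hinv_sq subrr.
- rewrite free_barB; apply/eqP; rewrite subr_eq0; apply/eqP.
  have M k l : free_bar (X_ k * X_ l * X_ k) = Hinv k * Hinv l * Hinv k.
    apply: (eq_trans (free_barM _ _)); rewrite free_barX; congr (_ * _).
    by apply: (eq_trans (free_barM _ _)); rewrite 2!free_barX.
  exact: (eq_trans (M i j) (eq_trans (Hinv_braid ij) (esym (M j i)))).
- exact: raddf0.
- by rewrite free_barB hx hy subrr.
- apply: (eq_trans (free_barM _ _)); apply: (eq_trans (congr1 (fun h => h * _) (free_barM _ _))).
  by rewrite hx mulr0 mul0r.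
Qed.

Definition bar (h : hecke) : hecke := free_bar (repr h).

Lemma bar_pi x : bar (\pi_hecke x) = free_bar x.
Proof.
apply/eqP; rewrite -subr_eq0 -free_barB; apply/eqP/free_bar_ideal.
by apply/hecke_piP; rewrite reprK.
Qed.

Lemma bar_is_additive : additive bar.
Proof.
elim/quotW=> x; elim/quotW=> y.
have -> : \pi_hecke x - \pi_hecke y = \pi_hecke (x - y) by rewrite !piE.
by rewrite !bar_pi free_barB.
Qed.

Lemma bar_is_multiplicative : multiplicative bar.
Proof.
split; last by rewrite (_ : 1 = \pi_hecke 1) // bar_pi free_bar1.
by elim/quotW=> x; elim/quotW=> y; rewrite [_ * _]hecke_pi_mul !bar_pi free_barM.
Qed.

HB.instance Definition _ := GRing.isAdditive.Build hecke hecke bar bar_is_additive.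
HB.instance Definition _ := GRing.isMultiplicative.Build hecke hecke bar bar_is_multiplicative.

Lemma barH i : bar (H_ i) = Hinv i.
Proof. by rewrite bar_pi free_barX. Qed.

Lemma barZ (c : laurent) (h : hecke) : bar (c *: h) = laurent_bar c *: bar h.
Proof. by elim/quotW: h => x; rewrite [c *: _]hecke_pi_scale !bar_pi free_barZ. Qed.

Lemma ell_inv w : ell w^-1%g = ell w.
Proof.
have le x : (ell x^-1%g <= ell x)%N.
  have [r [<- <-]] := exists_reduced x.
  have -> : ((expr r)^-1 = expr (rev r))%g by rewrite !exprE; apply: W_pi_inv.
  by rewrite ellE alc_expr -(size_rev r) (leq_trans (len_acts _ _)).
by apply/eqP; rewrite eqn_leq le /=; rewrite -{1}(invgK w) le.
Qed.

Lemma reduced_rev r w : reduced r w -> reduced (rev r) w^-1%g.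
Proof.
case=> <- sr; split; last by rewrite size_rev sr ell_inv.
by rewrite !exprE; apply/esym/W_pi_inv.
Qed.

Lemma std_inv r w : reduced r w -> (std w^-1%g)^-1 = \prod_(i <- r) Hinv i.
Proof.
move=> /reduced_rev/std_reduced ->; elim: r => [|i r IHr].
  by rewrite /hword /rev /= !big_nil invr1.
have u s : hword s \is a GRing.unit.
  elim: s => [|j s IHs]; first by rewrite /hword big_nil; apply: unitr1.
  by rewrite /hword big_cons (unitrMl _ IHs); apply: H_unit.
rewrite rev_cons hword_rcons (invrM (u _) (H_unit i)).
by rewrite big_cons IHr H_invE.
Qed.

Lemma bar_is_bar : is_bar bar.
Proof.
split=> [|w] /=; first by rewrite barZ rmorph1 /= laurent_bar_v.
have [r rw] := exists_reduced w; rewrite (std_inv rw) (std_reduced rw) /hword.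
by rewrite rmorph_prod; apply: eq_bigr => i _; apply: barH.
Qed.

Lemma mulr1_uniq (R : pzRingType) (x y z : R) : x * y = 1 -> y * z = 1 -> x = z.
Proof. by move=> xy yz; rewrite -[x]mulr1 -yz mulrA xy mul1r. Qed.

Lemma alg_mul (a b : laurent) : (a%:A : hecke) * b%:A = (a * b)%:A.
Proof. exact: (eq_trans (mulr_algl _ _) (scalerA _ _ _)). Qed.

(** The value at v forces the value at v^-1, and the Laurent polynomials are generated by
v and v^-1 as a ring. *)
Lemma is_bar_scalar (f : {rmorphism hecke -> hecke}) : f v%:A = v^-1%:A ->
  forall c, f c%:A = (laurent_bar c)%:A.
Proof.
move=> fv c.
have fM a b : f (a * b)%:A = f a%:A * f b%:A.
  by apply: (eq_trans _ (rmorphM f _ _)); congr (f _); apply/esym/alg_mul.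
have fD a b : f (a + b)%:A = f a%:A + f b%:A.
  by apply: (eq_trans _ (rmorphD f _ _)); congr (f _); apply: scalerDl.
have f1 : f 1%:A = 1%:A by rewrite scale1r rmorph1.
have vvV : v^-1 * v = 1 by rewrite mulrC mulvV.
have f_vV : f v^-1%:A = v%:A.
  have e : f v^-1%:A * v^-1%:A = 1.
    rewrite -[X in _ * X]fv; apply: (eq_trans (esym (fM _ _))).
    by rewrite vvV f1 scale1r.
  have e' : (v^-1%:A : hecke) * v%:A = 1.
    by apply: (eq_trans (alg_mul _ _)); rewrite vvV scale1r.
  exact: mulr1_uniq e e'.
have f_int (z : int) : f (z%:~R : laurent)%:A = (z%:~R : laurent)%:A.
  by rewrite scaler_int; apply: rmorph_int.
have fp p : f (poly_v p)%:A = (laurent_bar (poly_v p))%:A.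
  elim/poly_ind: p => [|p z IHp].
    by rewrite poly_v0 rmorph0 !scale0r rmorph0.
  have -> : poly_v (p * 'X + z%:P) = poly_v p * v + z%:~R.
    by rewrite poly_vE poly_atD poly_atM poly_atX poly_atC.
  have -> : laurent_bar (poly_v p * v + z%:~R) = laurent_bar (poly_v p) * v^-1 + z%:~R.
    by rewrite rmorphD rmorphM rmorph_int /= laurent_bar_v.
  apply: (eq_trans (fD _ _)); apply: (eq_trans _ (esym (scalerDl _ _ _))).
  congr (_ + _); last exact: f_int.
  apply: (eq_trans (fM _ _)); apply: (eq_trans _ (alg_mul _ _)).
  congr (_ * _); [exact: IHp|exact: fv].
have fVn n : f (v^-1 ^+ n)%:A = (v ^+ n)%:A.
  elim: n => [|n IHn]; first by rewrite (expr0 v^-1) (expr0 v); exact: f1.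
  rewrite (exprS v^-1) (exprS v); apply: (eq_trans (fM _ _)); apply: (eq_trans _ (alg_mul _ _)).
  congr (_ * _); [exact: f_vV|exact: IHn].
have [[p n] /= ->] := laurentP c.
have -> : laurent_bar (poly_v p * v^-1 ^+ n) = laurent_bar (poly_v p) * v ^+ n.
  by rewrite rmorphM rmorphXn /= laurent_bar_vV.
apply: (eq_trans (fM _ _)); apply: (eq_trans _ (alg_mul _ _)).
congr (_ * _); [exact: fp|exact: fVn].
Qed.

(** Every element is a sum of products of scalars and standard basis elements, and a bar
involution is prescribed on both. *)
Lemma is_bar_unique (f : {rmorphism hecke -> hecke}) h : is_bar f -> f h = bar h.
Proof.
move=> [fv fstd]; have [s ->] := hecke_span h.
rewrite (raddf_sum f) (raddf_sum bar); apply: eq_bigr => p _.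
have e (g : {rmorphism hecke -> hecke}) : is_bar g ->
    g (p.1 *: std p.2) = (laurent_bar p.1)%:A * (std p.2^-1%g)^-1.
  case=> gv gstd; rewrite -[X in g X]mulr_algl.
  apply: (eq_trans (rmorphM g _ _)).
  by congr (_ * _); [apply: is_bar_scalar|apply: gstd].
exact: (eq_trans (e f (conj fv fstd)) (esym (e bar bar_is_bar))).
Qed.

Lemma bar_invariantE h : bar_invariant h <-> bar h = h.
Proof.
split=> [[f [fbar e]]|e]; first by rewrite -(is_bar_unique _ fbar).
by exists bar; split; [apply: bar_is_bar|].
Qed.

(** * Uniqueness of Kazhdan-Lusztig elements *)

Lemma hcoef_sum z (I : Type) (r : seq I) (c : I -> laurent) (F : I -> hecke) :
  hcoef z (\sum_(k <- r) c k *: F k) = \sum_(k <- r) c k * hcoef z (F k).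
Proof. by rewrite (raddf_sum (hcoef z)); apply: eq_bigr => k _ /=; rewrite hcoefZ. Qed.

Lemma hcoefD z h h' : hcoef z (h + h') = hcoef z h + hcoef z h'.
Proof. exact: raddfD. Qed.
Lemma hcoefB z h h' : hcoef z (h - h') = hcoef z h - hcoef z h'.
Proof. exact: raddfB. Qed.

(** A spanning set together with the coefficient functions gives a basis. *)
Lemma hecke_expand h : exists2 r : seq W, uniq r &
  h = \sum_(x <- r) hcoef x h *: std x.
Proof.
have [s e] := hecke_span h; exists (undup [seq p.2 | p <- s]); first exact: undup_uniq.
rewrite [LHS]e.
have cE x : hcoef x h = \sum_(p <- s) p.1 * (x == p.2)%:R.
  by rewrite e hcoef_sum; apply: eq_bigr => p _; rewrite hcoef_std.
transitivity (\sum_(x <- undup [seq p.2 | p <- s])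
                \sum_(p <- s) (p.1 * (x == p.2)%:R) *: std x); last first.
  by apply: eq_bigr => x _; rewrite (cE x); apply/esym; exact: scaler_suml.
rewrite exchange_big /=; apply: eq_big_seq => p ps.
have mp : p.2 \in undup [seq p.2 | p <- s] by rewrite mem_undup map_f.
rewrite (bigD1_seq p.2) ?undup_uniq //= eqxx mulr1 big1 ?addr0 // => x /negPf ->.
by rewrite mulr0 scale0r.
Qed.

Lemma hcoef_inj h h' : (forall z, hcoef z h = hcoef z h') -> h = h'.
Proof.
move=> e; apply/eqP; rewrite -subr_eq0; have [r _ ->] := hecke_expand (h - h').
rewrite big1_seq // => x _.
by rewrite hcoefB e subrr scale0r.
Qed.

Lemma hcoef_mulHv z h i : hcoef z (h * (H_ i + v%:A)) =
  hcoef (z * s_ i)%g h + (if rdesc z i then v^-1 else v) * hcoef z h.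
Proof.
have e : h * (H_ i + v%:A) = h * H_ i + v *: h.
  by apply: (eq_trans (mulrDr _ _ _)); congr (_ + _); apply: mulr_algr.
rewrite e hcoefD hcoef_mulH hcoefZ.
by rewrite /q; case: (rdesc z i) => /=; ring.
Qed.

Lemma hcoef_Hinv z h i : hcoef z (h * Hinv i) =
  hcoef (z * s_ i)%g h + ((rdesc z i)%:R * q - q) * hcoef z h.
Proof.
have e : h * Hinv i = h * H_ i + - q *: h.
  apply: (eq_trans (mulrBr _ _ _)); congr (_ + _); rewrite scaleNr; congr (- _).
  exact: mulr_algr.
by rewrite e hcoefD hcoef_mulH hcoefZ; ring.
Qed.

(** Expand each factor [Hinv i] as [H_ i] minus a scalar: only the product of all the
[H_ i] can reach an element at least as long as the word. *)
Lemma hcoef_Hinv_prod (r : seq 'I_3) z : (size r <= ell z)%N ->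
  hcoef z (\prod_(i <- r) Hinv i) = (z == expr r)%:R.
Proof.
elim/last_ind: r z => [|r i IHr] z; first by rewrite /expr !big_nil hcoef1.
rewrite size_rcons -cats1 big_cat big_seq1 hcoef_Hinv cats1 expr_rcons => lz.
have lr : (ell (expr r) <= size r)%N by rewrite ellE alc_expr (leq_trans (len_acts _ _)).
rewrite !IHr; last first.
- by have := ell_s z i; lia.
- exact: ltnW.
have -> : (z == expr r) = false by apply: contraTF lz => /eqP ->; rewrite -leqNgt.
by rewrite mulr0 addr0 (can2_eq (s_mulK i) (s_mulK i)).
Qed.

Lemma hcoef_bar_std w z : (ell w <= ell z)%N -> hcoef z (bar (std w)) = (z == w)%:R.
Proof.
have [r rw] := exists_reduced w; have [_ e] := bar_is_bar.
rewrite (e w) (std_inv rw) => le; rewrite hcoef_Hinv_prod; first by case: rw => ->.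
by case: rw => _ ->.
Qed.

(** Let z be of maximal length among the elements whose standard coefficient is not zero.
As bar (std x) is std x plus terms of smaller length, invariance of [h] makes the coefficient at
z invariant; having only positive powers of v, it vanishes. *)
Lemma bar_invariant_eq0 h : bar h = h ->
  (forall z, exists p, hcoef z h = v * poly_v p) -> h = 0.
Proof.
move=> bh vh; have [r ur e] := hecke_expand h.
have out z : z \notin r -> hcoef z h = 0.
  move=> zr; rewrite e hcoef_sum big1_seq // => x /andP[_ xr].
  by rewrite hcoef_std; case: eqVneq zr => [->|]; rewrite ?xr ?mulr0.
(* Descending induction on the length of z, from above all lengths that occur in r. *)
suff z0 k z : (\max_(x <- r) ell x < ell z + k)%N -> hcoef z h = 0.
  by apply: hcoef_inj => z; rewrite (z0 (\max_(x <- r) ell x).+1) ?raddf0 // addnS ltnS leq_addl.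
elim: k z => [|k IHk] z lz.
  apply: out; apply: contraTN lz => zr; rewrite addn0 -leqNgt.
  exact: leq_bigmax_seq.
have [p pz] := vh z.
have zr : z \in r \/ hcoef z h = 0 by case: (boolP (z \in r)) => [|/out]; auto.
case: zr => // zr; suff bz : laurent_bar (hcoef z h) = hcoef z h.
  by move: bz; rewrite pz => /bar_invariant_vpoly ->; rewrite poly_v0 mulr0.
(* In the expansion of bar h only the term of z itself contributes at z. *)
have eb : h = \sum_(x <- r) laurent_bar (hcoef x h) *: bar (std x).
  rewrite -[LHS]bh [in LHS]e raddf_sum; apply: eq_bigr => x _; exact: barZ.
have rest x : x != z -> laurent_bar (hcoef x h) * hcoef z (bar (std x)) = 0.
  move=> xz; have [lx|lx] := leqP (ell x) (ell z).
    by rewrite (hcoef_bar_std lx) eq_sym (negPf xz) mulr0.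
  by rewrite IHk ?rmorph0 ?mul0r //; lia.
apply/esym/(eq_trans (congr1 (hcoef z) eb)); rewrite hcoef_sum.
apply: (eq_trans (bigD1_seq z zr ur)).
rewrite /= [X in _ + X]big1; last exact: rest.
rewrite addr0.
apply: (eq_trans (congr1 (fun t => laurent_bar (hcoef z h) * t) (hcoef_bar_std (leqnn (ell z))))).
by rewrite eqxx mulr1.
Qed.

Lemma hcoef_fsum (A : set W) (c : W -> laurent) z : finite_set A ->
  hcoef z (\sum_(x \in A) c x *: std x) = if z \in A then c z else 0.
Proof.
move=> fA; rewrite fsbig_finite //= hcoef_sum.
have [zA|zA] := boolP (z \in A).
  have zf : z \in fset_set A by rewrite (in_fset_set fA).
  rewrite (bigD1_seq z zf (fset_uniq _)) /= hcoef_std eqxx mulr1 big1 ?addr0 // => x xz.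
  by rewrite hcoef_std eq_sym (negPf xz) mulr0.
rewrite big1_seq // => x /andP[_ xA]; rewrite hcoef_std.
have {}xA : x \in A by rewrite -(in_fset_set fA).
by case: eqVneq zA => [->|]; rewrite ?xA ?mulr0.
Qed.

Lemma finite_bruhat w : finite_set [set x | bruhat_le x w].
Proof.
apply: sub_finite_set (finite_ell (ell w)) => x /= /bruhat_ell[->//|]; exact: ltnW.
Qed.

Lemma finite_bruhat_lt w : finite_set [set x | bruhat_lt x w].
Proof. by apply: sub_finite_set (finite_bruhat w) => x []. Qed.

Lemma hcoef_N x z : hcoef z (N_ x) = if `[< bruhat_le z x >] then v ^+ (ell x - ell z) else 0.
Proof.
rewrite hcoef_fsum; last exact: finite_bruhat.
by congr (if _ then _ else _); apply/idP/asboolP; rewrite in_setE.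
Qed.

Lemma hcoef_is_KL w h z : is_KL w h -> exists p, hcoef z h = (z == w)%:R + v * poly_v p.
Proof.
case=> -[p ->] _; exists (if z \in [set x | bruhat_lt x w] then p z else 0).
rewrite hcoefD hcoef_std hcoef_fsum; last exact: finite_bruhat_lt.
by case: ifP => // _; rewrite poly_v0 mulr0.
Qed.

Lemma is_KL_unique w h h' : is_KL w h -> is_KL w h' -> h = h'.
Proof.
move=> kh kh'; apply/eqP; rewrite -subr_eq0; apply/eqP/bar_invariant_eq0.
  by rewrite raddfB /= !(iffLR (bar_invariantE _)) //; [case: kh'|case: kh].
move=> z; have [p e] := hcoef_is_KL z kh; have [p' e'] := hcoef_is_KL z kh'.
exists (p - p'); rewrite hcoefB e e' !poly_vE poly_atB; ring.
Qed.

(** A self-dual element with the triangular shape is the Kazhdan-Lusztig element, because the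
difference of two of them is self-dual with all coefficients divisible by v. *)
Lemma KL_intro w h : bar h = h -> hcoef w h = 1 ->
  (forall z, ~ bruhat_le z w -> hcoef z h = 0) ->
  (forall z, exists p, hcoef z h = (z == w)%:R + v * poly_v p) ->
  KL w = h.
Proof.
move=> bh h1 supp vh; have [p pE] := choice vh.
suff kh : is_KL w h.
  apply: (is_KL_unique _ kh).
  exact: (xgetPex 0 (P := is_KL w) (ex_intro _ h kh)).
split; last exact/bar_invariantE.
exists p; apply: hcoef_inj => z.
rewrite hcoefD hcoef_std hcoef_fsum; last exact: finite_bruhat_lt.
have [zw|] := boolP (z \in [set x | bruhat_lt x w]); first exact: pE.
rewrite notin_setE /= addr0 => nz; have [->//|/eqP zw] := eqVneq z w.
by rewrite supp // => zle; apply: nz.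
Qed.

(** * Hexagons *)

(** Write the vertex of colour [c] of the alcove in the coordinates of sum 0 in which the
positive roots are differences of coordinates.  [vert1], [vert2] and [vert3] are these
coordinates, multiplied by 3 to be integers. *)
Definition vert1 (c : 'I_3) (A : alcove) : int :=
  3 * px A + match val c, dir A with
  | 0%N, _ => 0
  | 1%N, (Oe | O2) => 2
  | 1%N, _ => -1
  | _, (O12 | O121) => -2
  | _, _ => 1
  end.

Definition vert3 (c : 'I_3) (A : alcove) : int :=
  - 3 * py A + match val c, dir A with
  | 0%N, _ => 0
  | 1%N, (O21 | O121) => 2
  | 1%N, _ => -1
  | _, (Oe | O1) => -2
  | _, _ => 1
  end.

Definition vert2 (c : 'I_3) (A : alcove) : int := - (vert1 c A + vert3 c A).

(** The vertex of colour n - m lies in the convex hull of the orbit, under the finite Weyl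
group, of the dominant weight n omega_1 + m omega_2.  Its coordinates times 3 are 2n + m, m - n
and -(2m + n), so the hull is cut out by the largest and the smallest of them.  For negative
[m] or [n] the hexagon is empty, which lets the identities below hold at the boundary. *)
Definition hex (m n : int) (A : alcove) : bool :=
  let c := index_mod3 (n - m) in
  [&& 0 <= m, 0 <= n,
   - (2 * m + n) <= vert1 c A <= 2 * n + m,
   - (2 * m + n) <= vert2 c A <= 2 * n + m &
   - (2 * m + n) <= vert3 c A <= 2 * n + m].

Lemma index_mod3E (k : int) : exists q : int,
  [\/ k = 3 * q /\ index_mod3 k = gen0, k = 3 * q + 1 /\ index_mod3 k = gen1 |
      k = 3 * q + 2 /\ index_mod3 k = gen2].
Proof.
exists (k %/ 3)%Z; rewrite /index_mod3.
have e := divz_eq k 3; have h1 : (0 <= (k %% 3)%Z) by exact: modz_ge0.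
have h2 : ((k %% 3)%Z < 3) by apply: ltz_pmod.
have : [\/ (k %% 3)%Z = 0, (k %% 3)%Z = 1 | (k %% 3)%Z = 2].
  by case: (k %% 3)%Z h1 h2 => // -[|[|[|p]]] // _ _; [constructor 1|constructor 2|constructor 3].
case=> r; rewrite r in e *; [constructor 1|constructor 2|constructor 3];
  (split; [by rewrite {1}e; lia|by apply: val_inj; rewrite /= inordK]).
Qed.

Lemma descE A i : desc A i =
  [|| (shi_a (act A i) == shi_a A - 1) && (0 < shi_a A),
      (shi_a (act A i) == shi_a A + 1) && (shi_a A < 0),
      (shi_b (act A i) == shi_b A - 1) && (0 < shi_b A),
      (shi_b (act A i) == shi_b A + 1) && (shi_b A < 0),
      (shi_c (act A i) == shi_c A - 1) && (0 < shi_c A) |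
      (shi_c (act A i) == shi_c A + 1) && (shi_c A < 0)].
Proof.
rewrite /desc /len; case: (act_step A i) => -[_ []] [-> -> ->]; lia.
Qed.

(** The colours k, k + 1 and k - 1 are the three colours in cyclic order. *)
Lemma colour_step (k : int) : exists q : int,
  [\/ [/\ k = 3 * q, index_mod3 k = gen0,
          index_mod3 (k + 1) = gen1 & index_mod3 (k - 1) = gen2],
      [/\ k = 3 * q + 1, index_mod3 k = gen1,
          index_mod3 (k + 1) = gen2 & index_mod3 (k - 1) = gen0] |
      [/\ k = 3 * q + 2, index_mod3 k = gen2,
          index_mod3 (k + 1) = gen0 & index_mod3 (k - 1) = gen1]].
Proof.
have [q hq] := index_mod3E k; have [q1 hq1] := index_mod3E (k + 1).
have [q2 hq2] := index_mod3E (k - 1); exists q.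
case: hq => -[e ->]; [constructor 1|constructor 2|constructor 3]; split=> //.
all: by [case: hq1 => -[e1 ->] //; lia|case: hq2 => -[e2 ->] //; lia].
Qed.

Section HexFacts.
Variables m n : int.
Local Notation s := (index_mod3 (n - m)).
Local Notation t := (index_mod3 (n - m + 1)).
Local Notation u := (index_mod3 (n - m - 1)).

Let c1 : n - (m - 1) = n - m + 1. Proof. lia. Qed.
Let c2 : n - 1 - m = n - m - 1. Proof. lia. Qed.
Let c3 : n - 1 - (m - 1) = n - m. Proof. lia. Qed.
Let c4 : n - (m + 1) = n - m - 1. Proof. lia. Qed.
Let c5 : n + 1 - m = n - m + 1. Proof. lia. Qed.
Lemma index_mod3_shift_u : index_mod3 (n + 1 - (m - 1)) = u.
Proof.
have [q] := colour_step (n - m); have [q'] := index_mod3E (n + 1 - (m - 1)).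
by case=> -[e ->]; case=> -[e' _ _ ->] //; lia.
Qed.

Lemma index_mod3_shift_t : index_mod3 (n - 1 - (m + 1)) = t.
Proof.
have [q] := colour_step (n - m); have [q'] := index_mod3E (n - 1 - (m + 1)).
by case=> -[e ->]; case=> -[e' _ -> _] //; lia.
Qed.

Hypotheses (m0 : 0 <= m) (n0 : 0 <= n).

(** The residue of n - m modulo 3 fixes the three colours, and the six directions make all
coordinates explicit; what remains is linear arithmetic. *)
Ltac hexlia A :=
  rewrite /hex ?c1 ?c2 ?c3 ?c4 ?c5 ?index_mod3_shift_u ?index_mod3_shift_t ?descE; move: m0 n0;
  have [q] := colour_step (n - m);
  case=> -[]; move=> /eqP; rewrite subr_eq => /eqP;
  (let e := fresh in let h1 := fresh in let h2 := fresh in let h3 := fresh in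
   move=> e h1 h2 h3; rewrite ?h1 ?h2 ?h3 {h1 h2 h3} e {e});
  case: A => x y [];
  rewrite /vert2 /vert1 /vert3 /shi_a /shi_b /shi_c /=; lia.

(** Membership in the hexagon changes only when the vertex of colour [s] moves, and moving
it away from the fundamental alcove leads out of the hexagon rather than into it. *)
Lemma hex_closed A : ~~ desc A s -> hex m n (act A s) -> hex m n A.
Proof. hexlia A. Qed.

(** An alcove stays in the hexagon (m,n) when it is moved up across its wall of type [s] if
and only if it lies in one of the two smaller hexagons (m-1,n) and (m,n-1), whose colours are [t]
and [u].  With [hex_cap] this is the content of the first product formula. *)
Lemma hex_upper A : ~~ desc A s ->
  hex m n (act A s) = hex (m - 1) n A || hex m (n - 1) A.
Proof. hexlia A. Qed.
Lemma hex_cap A : ~~ desc A s ->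
  hex (m - 1) n A && hex m (n - 1) A = hex (m - 1) (n - 1) A.
Proof. hexlia A. Qed.

(** Enlarge the hexagon (m,n) by its neighbours of type [s].  The hexagon (m+1,n) consists of
the pairs of alcoves with a common wall of type [t] whose lower member is in the enlarged set;
likewise for (m,n+1) and [u]. *)
Lemma hexS_t A : ~~ desc A t ->
  hex m n A || hex m n (act A s) = hex (m + 1) n A.
Proof. hexlia A. Qed.

Lemma hexS_u A : ~~ desc A u ->
  hex m n A || hex m n (act A s) = hex m (n + 1) A.
Proof. hexlia A. Qed.

(** With [hexS_cap_t], the equality of the sums of two pairs of indicator functions needed
for multiplying N_(theta(m,n)s) by H_t + v.  The two lemmas after that are the mirror images
for [u]. *)
Lemma hexS_cup_t A : ~~ desc A t ->
  (hex m n (act A t) || hex m n (act (act A t) s)) || hex (m - 1) n A =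
   hex m n A || hex (m - 1) (n + 1) A.
Proof. hexlia A. Qed.

Lemma hexS_cap_t A : ~~ desc A t ->
  (hex m n (act A t) || hex m n (act (act A t) s)) && hex (m - 1) n A =
   hex m n A && hex (m - 1) (n + 1) A.
Proof. hexlia A. Qed.

Lemma hexS_cup_u A : ~~ desc A u ->
  (hex m n (act A u) || hex m n (act (act A u) s)) || hex m (n - 1) A =
   hex m n A || hex (m + 1) (n - 1) A.
Proof. hexlia A. Qed.

Lemma hexS_cap_u A : ~~ desc A u ->
  (hex m n (act A u) || hex m n (act (act A u) s)) && hex m (n - 1) A =
   hex m n A && hex (m + 1) (n - 1) A.
Proof. hexlia A. Qed.

(** The Shi coordinates of the alcove of theta(m,n). *)
Definition at_theta (A : alcove) : Prop :=
  [/\ shi_a A = - m - 1, shi_b A = - n - 1 & shi_c A = - m - n - 1].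

Ltac thetalia A :=
  rewrite /at_theta; have [q] := colour_step (n - m);
  case=> -[]; move=> /eqP; rewrite subr_eq => /eqP;
  (let e := fresh in let h1 := fresh in let h2 := fresh in let h3 := fresh in
   move=> e h1 h2 h3; rewrite ?h1 ?h2 ?h3 {h1 h2 h3} e {e});
  case: A => x y []; rewrite /shi_a /shi_b /shi_c /= => -[? ? ?];
  (split; lia) || (exfalso; lia).

Lemma at_theta_s A : at_theta A ->
  [/\ shi_a (act A s) = - m - 1, shi_b (act A s) = - n - 1 & shi_c (act A s) = - m - n - 2].
Proof. thetalia A. Qed.

Lemma at_theta_st A : at_theta A ->
  [/\ shi_a (act (act A s) t) = - m - 2, shi_b (act (act A s) t) = - n - 1
    & shi_c (act (act A s) t) = - m - n - 2].
Proof. thetalia A. Qed.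

Lemma at_theta_su A : at_theta A ->
  [/\ shi_a (act (act A s) u) = - m - 1, shi_b (act (act A s) u) = - n - 2
    & shi_c (act (act A s) u) = - m - n - 2].
Proof. thetalia A. Qed.

End HexFacts.

Lemma vert_act c i A : i != c ->
  vert1 c (act A i) = vert1 c A /\ vert3 c (act A i) = vert3 c A.
Proof.
move: A; elim/ord3_ind: c; elim/ord3_ind: i => // -[x y []] _;
  rewrite /vert1 /vert3 /=; split; lia.
Qed.

Lemma hex_act m n i A : i != index_mod3 (n - m) -> hex m n (act A i) = hex m n A.
Proof. by move=> /vert_act h; rewrite /hex /vert2; have [-> ->] := h A. Qed.

(** Hexagons with the same colour are nested. *)
Lemma hex_step m n A : hex m n A -> hex (m + 1) (n + 1) A.
Proof.
have e : n + 1 - (m + 1) = n - m by lia.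
rewrite /hex e; move: (vert1 _ _) (vert2 _ _) (vert3 _ _) => a b c; lia.
Qed.

Lemma hex00 A : hex 0 0 A = (px A == 0) && (py A == 0).
Proof.
have [q] := colour_step (0 - 0); rewrite /hex.
case=> -[e -> _ _]; try lia.
by case: A => x y o; rewrite /vert2 /vert1 /vert3 /=; lia.
Qed.

(** * Lower intervals of theta(m,n) and theta(m,n)s *)

Lemma index_mod3_add (k q : int) : index_mod3 (k + 3 * q) = index_mod3 k.
Proof. by rewrite /index_mod3 addrC mulrC modzMDl. Qed.

(** Replacing n by n + 1 appends two letters to the word of theta(m,n): the ascent s, and
then one of the other two generators. *)
Lemma thetaSn (m n : nat) : theta m n.+1 =
  (theta m n * s_ (index_mod3 (n%:Z - m%:Z)) * s_ (index_mod3 (n%:Z - m%:Z - 1)))%g.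
Proof.
rewrite /theta -!expr_rcons; congr expr; rewrite /theta_word.
rewrite (_ : 2 * n.+1 + 1 = (2 * n + 1) + 2)%N; last by lia.
rewrite (iotaD 0 (2 * n + 1)) map_cat add0n -!cats1 -!catA; congr (_ ++ (_ ++ _)).
rewrite /=.
by congr [:: _; _]; rewrite -(index_mod3_add _ (n%:Z - m%:Z)); congr index_mod3; lia.
Qed.

(** The word of theta(m+1,0) arises by changing the last letter of the word of theta(m,0)
and adding two; a braid relation moves the change to the end. *)
Lemma thetaSm (m : nat) : theta m.+1 0 =
  (theta m 0 * s_ (index_mod3 (0%:Z - m%:Z)) * s_ (index_mod3 (0%:Z - m%:Z + 1)))%g.
Proof.
pose p := [seq index_mod3 (1 + i%:Z) | i <- iota 0 (2 * m + 2)].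
set s := index_mod3 _; set t := index_mod3 _.
have st : s != t.
  by rewrite /s /t; have [q] := colour_step (0%:Z - m%:Z); case=> -[_ -> -> _].
have -> : theta m 0 = (expr p * s_ t)%g.
  rewrite -expr_rcons -cats1 /theta /theta_word /=; congr (expr (_ ++ [:: _])).
  by rewrite /t -(index_mod3_add (0%:Z - m%:Z + 1) m%:Z); congr index_mod3; lia.
have -> : theta m.+1 0 = (expr p * s_ s * s_ t * s_ s)%g.
  rewrite -!expr_rcons; congr expr; rewrite /theta_word.
  rewrite (_ : 2 * m.+1 + 2 = (2 * m + 2) + 2)%N; last by lia.
  rewrite (iotaD 0 (2 * m + 2)) map_cat add0n -!cats1 -!catA; congr (_ ++ _).
  rewrite /=.
  by congr [:: _; _; _];
    [rewrite /s -(index_mod3_add (0%:Z - m%:Z) (m%:Z + 1))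
    |rewrite /t -(index_mod3_add (0%:Z - m%:Z + 1) (m%:Z + 1))
    |rewrite /s -(index_mod3_add (0%:Z - m%:Z) (m%:Z + 1))]; congr index_mod3; lia.
exact: s_mulA3.
Qed.

Lemma theta00 : theta 0 0 = (s_ gen1 * s_ gen2 * s_ gen1)%g.
Proof.
rewrite /theta.
have e1 : index_mod3 1 = gen1 by apply: val_inj; rewrite /= inordK.
have e2 : index_mod3 2 = gen2 by apply: val_inj; rewrite /= inordK.
have -> : theta_word 0 0 = [:: index_mod3 1; index_mod3 2; index_mod3 1] by [].
by rewrite e1 e2 /expr !big_cons big_nil mulg1 mulgA.
Qed.

Lemma alc_theta m n : at_theta m%:Z n%:Z (alc (theta m n)).
Proof.
elim: n => [|n IHn].
  elim: m => [|m IHm].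
    by rewrite theta00 !alc_s -[s_ gen1]mul1g alc_s alc1 /at_theta; split.
  rewrite /at_theta thetaSm !alc_s; have [-> -> ->] := at_theta_st (le0z_nat _) (le0z_nat _) IHm.
  by split; lia.
rewrite /at_theta thetaSn !alc_s; have [-> -> ->] := at_theta_su (le0z_nat _) (le0z_nat _) IHn.
by split; lia.
Qed.

Lemma ell_theta m n : ell (theta m n) = (2 * m + 2 * n + 3)%N.
Proof. by rewrite ellE /len; have [-> -> ->] := alc_theta m n; lia. Qed.

Definition colour (m n : int) : 'I_3 := index_mod3 (n - m).

Definition theta_s (m n : nat) : W := (theta m n * s_ (colour m%:Z n%:Z))%g.

Lemma ell_theta_s m n : ell (theta_s m n) = (2 * m + 2 * n + 4)%N.
Proof.
rewrite ellE /len /theta_s alc_s.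
by have [-> -> ->] := at_theta_s (le0z_nat _) (le0z_nat _) (alc_theta m n); lia.
Qed.

Definition coset_min (w : W) (i : 'I_3) : W := if rdesc w i then (w * s_ i)%g else w.

Lemma rdesc_coset_min w i : rdesc (coset_min w i) i = false.
Proof. by rewrite /coset_min; case: ifP => // h; rewrite rdesc_s h. Qed.

(** The lower interval of [w s_i] is stable under [s_ i], hence determined by the elements in it
that do not have [i] as a descent. *)
Lemma bruhat_coset_min w i z : (ell w < ell (w * s_ i)%g)%N ->
  bruhat_le z (w * s_ i)%g <-> bruhat_le (coset_min z i) w.
Proof.
move=> lw; rewrite (bruhat_mul_s _ lw) /coset_min; case: ifP => d.
  split=> [[h|//]|]; last by right.
  apply: bruhat_trans h; rewrite -{2}[z](s_mulK i).
  by apply: bruhat_s; rewrite s_mulK.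
split=> [[//|h]|]; last by left.
apply: bruhat_trans h; apply: bruhat_s.
by have := ell_s z i; move: d; rewrite /rdesc; lia.
Qed.

Definition hexW (m n : int) (w : W) : bool := hex m n (alc w).

Lemma hexW_s m n i z : i != colour m n -> hexW m n (z * s_ i)%g = hexW m n z.
Proof. by rewrite /hexW alc_s; apply: hex_act. Qed.

Lemma hexW_coset_min m n i z : i != colour m n -> hexW m n (coset_min z i) = hexW m n z.
Proof. by move=> h; rewrite /coset_min; case: ifP => // _; apply: hexW_s. Qed.

Lemma hexW_coset_min_colour m n z : 0 <= m -> 0 <= n -> hexW m n (coset_min z (colour m n)) =
  hexW m n z || hexW m n (z * s_ (colour m n))%g.
Proof.
move=> m0 n0; have cl y : ~~ rdesc y (colour m n) -> hexW m n (y * s_ (colour m n))%g ->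
  hexW m n y.
  by rewrite rdescE /hexW alc_s; apply: hex_closed.
rewrite /coset_min; case: ifP => d.
  have := cl (z * s_ (colour m n))%g; rewrite rdesc_s d s_mulK => /(_ isT).
  by case: (hexW m n z) => // ->.
have := cl z; rewrite d => /(_ isT).
by case: (hexW m n (_ * _)%g) => [->//|]; rewrite orbF.
Qed.

Lemma colour_neq m n :
  index_mod3 (n - m + 1) != colour m n /\ index_mod3 (n - m - 1) != colour m n.
Proof. by rewrite /colour; have [q] := colour_step (n - m); case=> -[_ -> -> ->]. Qed.

(** Adding to the hexagon (m,n) its neighbours of type s and then those of type t gives the
hexagon (m+1,n).  By the lifting property the same construction leads from the lower interval of
theta(m,n) to that of theta(m,n) s t = theta(m+1,n). *)
Lemma hexW_t m n z : 0 <= m -> 0 <= n -> let t := index_mod3 (n - m + 1) in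
  hexW m n (coset_min (coset_min z t) (colour m n)) = hexW (m + 1) n z.
Proof.
move=> m0 n0 t; rewrite hexW_coset_min_colour //.
have := hexS_t m0 n0 (A := alc (coset_min z t)).
rewrite -rdescE rdesc_coset_min -alc_s => /(_ isT).
rewrite /hexW => ->; apply: hexW_coset_min.
have [q] := colour_step (n - m); rewrite /t /colour (_ : n - (m + 1) = n - m - 1); last by lia.
by case=> -[_ _ -> ->].
Qed.

Lemma hexW_u m n z : 0 <= m -> 0 <= n -> let u := index_mod3 (n - m - 1) in
  hexW m n (coset_min (coset_min z u) (colour m n)) = hexW m (n + 1) z.
Proof.
move=> m0 n0 u; rewrite hexW_coset_min_colour //.
have := hexS_u m0 n0 (A := alc (coset_min z u)).
rewrite -rdescE rdesc_coset_min -alc_s => /(_ isT).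
rewrite /hexW => ->; apply: hexW_coset_min.
have [q] := colour_step (n - m); rewrite /u /colour (_ : n + 1 - m = n - m + 1); last by lia.
by case=> -[_ _ -> ->].
Qed.

Lemma hexW00 z : hexW 0 0 z <-> bruhat_le z (theta 0 0).
Proof.
have l1 : (ell 1%g < ell (1 * s_ gen1)%g)%N by rewrite !ellE alc_s alc1.
have l2 : (ell (1 * s_ gen1)%g < ell (1 * s_ gen1 * s_ gen2)%g)%N by rewrite !ellE !alc_s alc1.
have l3 : (ell (1 * s_ gen1 * s_ gen2)%g < ell (1 * s_ gen1 * s_ gen2 * s_ gen1)%g)%N.
  by rewrite !ellE !alc_s alc1.
rewrite theta00 -[s_ gen1 in X in bruhat_le z (X * _ * _)%g]mul1g.
rewrite (bruhat_mul_s _ l3) !(bruhat_mul_s _ l2) !(bruhat_mul_s _ l1) !bruhat_1.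
have E x : x = 1%g <-> alc x = alcove0 by split=> [->|e]; [rewrite alc1|apply: alc_inj;
  rewrite alc1].
rewrite !E !alc_s /hexW hex00.
case: (alc z) => x y o /=; split=> [/andP[/eqP -> /eqP ->]|].
  by case: o => /=; intuition.
by case: o => /=; intuition; match goal with H : _ = _ |- _ => case: H => *; subst end.
Qed.

(** Induction by the lifting property, adding two letters at a time. *)
Lemma bruhat_theta m n z : bruhat_le z (theta m n) <-> hexW m%:Z n%:Z z.
Proof.
elim: n z => [|n IHn].
  elim: m => [|m IHm] z; first by rewrite -hexW00.
  rewrite thetaSm bruhat_coset_min ?bruhat_coset_min ?IHm; last 2 first.
  - by rewrite ell_theta -/(theta_s m 0) ell_theta_s; lia.
  - by rewrite -thetaSm ell_theta -/(theta_s m 0) ell_theta_s; lia.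
  by rewrite (hexW_t z (m := m) (n := 0)) // addrC -intS.
move=> z; rewrite thetaSn bruhat_coset_min ?bruhat_coset_min ?IHn; last 2 first.
- by rewrite ell_theta -/(theta_s m n) ell_theta_s; lia.
- by rewrite -thetaSn ell_theta -/(theta_s m n) ell_theta_s; lia.
by rewrite (hexW_u z (m := m) (n := n)) // addrC -intS.
Qed.

Lemma bruhat_theta_s m n z :
  bruhat_le z (theta_s m n) <-> hexW m%:Z n%:Z (coset_min z (colour m%:Z n%:Z)).
Proof.
by rewrite bruhat_coset_min ?bruhat_theta // -/(theta_s m n) ell_theta ell_theta_s; lia.
Qed.

(** * Products of the elements N *)

(** The elements N for theta(m,n) and theta(m,n)s, set to 0 when an index is negative.  With
this convention the product formulas have no boundary cases. *)
Definition Ntheta (m n : int) : hecke :=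
  match m, n with Posz m, Posz n => N_ (theta m n) | _, _ => 0 end.

Definition Ntheta_s (m n : int) : hecke :=
  match m, n with Posz m, Posz n => N_ (theta_s m n) | _, _ => 0 end.

Lemma hcoef0 z : hcoef z 0 = 0. Proof. exact: raddf0. Qed.

Lemma hexW_neg (m n : int) z : ~~ ((0 <= m) && (0 <= n)) -> hexW m n z = false.
Proof. by rewrite /hexW /hex; case: (0 <= m) => //=; case: (0 <= n). Qed.

Lemma hcoef_Ntheta m n z : hcoef z (Ntheta m n) =
  (hexW m n z)%:R * v ^ (2 * m + 2 * n + 3 - (ell z)%:Z).
Proof.
have neg : ~~ ((0 <= m) && (0 <= n)) -> Ntheta m n = 0 ->
    hcoef z (Ntheta m n) = (hexW m n z)%:R * v ^ (2 * m + 2 * n + 3 - (ell z)%:Z).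
  by move=> /hexW_neg -> ->; rewrite hcoef0 mul0r.
case: m neg => [m|m] neg; last by apply: neg.
case: n neg => [n|n] neg; last by apply: neg.
rewrite hcoef_N ell_theta; case: asboolP => [/bruhat_theta h|/bruhat_theta h]; last first.
  by rewrite (negPf (introN idP h)) mul0r.
rewrite h mul1r; have : (ell z <= ell (theta m n))%N.
  by move/bruhat_theta: h => /bruhat_ell[->|/ltnW].
rewrite ell_theta => le; rewrite exprnP; congr (_ ^ _); lia.
Qed.

Lemma hcoef_Ntheta_s m n z : hcoef z (Ntheta_s m n) =
  (hexW m n (coset_min z (colour m n)))%:R * v ^ (2 * m + 2 * n + 4 - (ell z)%:Z).
Proof.
have neg : ~~ ((0 <= m) && (0 <= n)) -> Ntheta_s m n = 0 ->
    hcoef z (Ntheta_s m n) = (hexW m n (coset_min z (colour m n)))%:R * v ^ (2 * m + 2 * n + 4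
      - (ell z)%:Z).
  by move=> /hexW_neg -> ->; rewrite hcoef0 mul0r.
case: m neg => [m|m] neg; last by apply: neg.
case: n neg => [n|n] neg; last by apply: neg.
rewrite hcoef_N ell_theta_s; case: asboolP => [/bruhat_theta_s h|/bruhat_theta_s h]; last first.
  by rewrite (negPf (introN idP h)) mul0r.
rewrite h mul1r; have : (ell z <= ell (theta_s m n))%N.
  by move/bruhat_theta_s: h => /bruhat_ell[->|/ltnW].
rewrite ell_theta_s => le; rewrite exprnP; congr (_ ^ _); lia.
Qed.

Lemma vexpB (k : int) (j : nat) : v ^ (k - j%:Z) = v ^ k * v^-1 ^+ j.
Proof. by rewrite (exprzDr v_unit) -exprnN exprVn. Qed.

Fact mulHv_arith_up (R : comPzRingType) (a b c w : R) :
  b * c + w * (a * (c * w ^+ 1)) = (b + w ^+ 2 * a) * c.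
Proof. ring. Qed.

Fact mulHv_arith_down (R : comPzRingType) (a b c x w : R) : x * w = 1 ->
  b * (c * w ^+ 2) + x * (a * (c * w ^+ 1)) = (a + w ^+ 2 * b) * c.
Proof. by move=> e; ring: e. Qed.

(** The elements to be multiplied have coefficients of the form chi(y) v^(K - ell y).
Multiplication by H_i + v preserves this form and acts on chi as displayed, so that a product
formula becomes an identity between functions chi constant on the pairs {z, z s_i}. *)
Lemma hcoef_graded_mulHv h (chi : W -> laurent) (K : int) i z :
  (forall y, hcoef y h = chi y * v ^ (K - (ell y)%:Z)) ->
  hcoef z (h * (H_ i + v%:A)) =
  (chi (coset_min z i) + v^-1 ^+ 2 * chi (coset_min z i * s_ i)%g) * v ^ (K + 1 - (ell z)%:Z).
Proof.
move=> hh; rewrite hcoef_mulHv !hh /coset_min.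
have e := mulvV; have := ell_s z i; case: ifP => d [l|l]; try (by move: d; rewrite /rdesc l; lia).
  rewrite s_mulK (_ : K - (ell z)%:Z = K + 1 - (ell z)%:Z - 1%:Z); last by lia.
  rewrite (_ : K - (ell (z * s_ i)%g)%:Z = K + 1 - (ell z)%:Z); last by rewrite l; lia.
  by rewrite (vexpB _ 1); apply: mulHv_arith_up.
rewrite (_ : K - (ell z)%:Z = K + 1 - (ell z)%:Z - 1%:Z); last by lia.
rewrite (_ : K - (ell (z * s_ i)%g)%:Z = K + 1 - (ell z)%:Z - 2%:Z); last by rewrite l; lia.
by rewrite (vexpB _ 1) (vexpB _ 2); apply: mulHv_arith_down.
Qed.

Fact raddf_comb4 (R : comNzRingType) (V : lmodType R) (f : {additive V -> R})
  (h1 h2 h3 h4 : V) (a b c : R) : (forall k x, f (k *: x) = k * f x) ->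
  f (h1 + a *: h2 + b *: h3 - c *: h4) =
  f h1 + a * f h2 + b * f h3 - c * f h4.
Proof. by move=> fZ; rewrite raddfB 2!raddfD /= 3!fZ. Qed.

Lemma hcoef_comb4 z (h1 h2 h3 h4 : hecke) (a b c : laurent) :
  hcoef z (h1 + a *: h2 + b *: h3 - c *: h4) =
  hcoef z h1 + a * hcoef z h2 + b * hcoef z h3 - c * hcoef z h4.
Proof. exact: (raddf_comb4 h1 h2 h3 h4 a b c (hcoefZ z)). Qed.

Lemma colour_m1 m n : colour (m - 1) n = index_mod3 (n - m + 1).
Proof. by rewrite /colour; congr index_mod3; lia. Qed.
Lemma colour_n1 m n : colour m (n - 1) = index_mod3 (n - m - 1).
Proof. by rewrite /colour; congr index_mod3; lia. Qed.
Lemma colour_mn1 m n : colour (m - 1) (n - 1) = colour m n.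
Proof. by rewrite /colour; congr index_mod3; lia. Qed.

(** With chi the indicator function of the hexagon (m,n), the new chi is 1 on the hexagon plus
v^-2 on the alcoves that stay inside when moved up.  By [hex_upper] and [hex_cap] these form the
union of the hexagons (m-1,n) and (m,n-1), with intersection the hexagon (m-1,n-1), and
inclusion-exclusion gives the formula. *)
Lemma Ntheta_mul_s (m n : int) : 0 <= m -> 0 <= n ->
  Ntheta m n * (H_ (colour m n) + v%:A) =
  Ntheta_s m n + v *: Ntheta (m - 1) n + v *: Ntheta m (n - 1)
  - v ^+ 2 *: Ntheta_s (m - 1) (n - 1).
Proof.
move=> m0 n0; apply: hcoef_inj => z; set s := colour m n.
rewrite (hcoef_graded_mulHv s z (hcoef_Ntheta m n)).
rewrite hcoef_comb4 (hcoef_Ntheta_s m n) (hcoef_Ntheta (m - 1) n) (hcoef_Ntheta m (n - 1)).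
rewrite (hcoef_Ntheta_s (m - 1) (n - 1)).
have [ct cu] : s != colour (m - 1) n /\ s != colour m (n - 1).
  by rewrite colour_m1 colour_n1 ![s == _]eq_sym; apply: colour_neq.
rewrite colour_mn1.
rewrite -/s -(hexW_coset_min z ct) -(hexW_coset_min z cu).
have nd : ~~ desc (alc (coset_min z s)) s by rewrite -rdescE rdesc_coset_min.
have := hex_upper m0 n0 nd; have := hex_cap m0 n0 nd; rewrite -alc_s -!/(hexW _ _ _).
move=> <- ->.
set E := v ^ (2 * m + 2 * n + 3 + 1 - (ell z)%:Z).
have -> : 2 * m + 2 * n + 4 - (ell z)%:Z = 2 * m + 2 * n + 3 + 1 - (ell z)%:Z by lia.
have -> : 2 * (m - 1) + 2 * n + 3 - (ell z)%:Z = 2 * m + 2 * n + 3 + 1 - (ell z)%:Z - 3%:Z by lia.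
have -> : 2 * m + 2 * (n - 1) + 3 - (ell z)%:Z = 2 * m + 2 * n + 3 + 1 - (ell z)%:Z - 3%:Z by lia.
have -> : 2 * (m - 1) + 2 * (n - 1) + 4 - (ell z)%:Z =
  2 * m + 2 * n + 3 + 1 - (ell z)%:Z - 4%:Z by lia.
rewrite !(vexpB _ 3) (vexpB _ 4) -/E; have e := mulvV; move: E => E.
by case: (hexW (m - 1) n _); case: (hexW m (n - 1) _) => /=; ring: e.
Qed.

Fact raddf_comb2 (R : comNzRingType) (V : lmodType R) (f : {additive V -> R})
  (h1 h2 : V) (a : R) : (forall k x, f (k *: x) = k * f x) ->
  f (h1 + a *: h2) = f h1 + a * f h2.
Proof. by move=> fZ; rewrite raddfD /= fZ. Qed.

Lemma hcoef_comb2 z (h1 h2 : hecke) (a : laurent) :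
  hcoef z (h1 + a *: h2) = hcoef z h1 + a * hcoef z h2.
Proof. exact: (raddf_comb2 h1 h2 a (hcoefZ z)). Qed.

Lemma colour_mnp m n : colour (m - 1) (n + 1) = index_mod3 (n - m - 1).
Proof. exact: index_mod3_shift_u. Qed.
Lemma colour_mpn m n : colour (m + 1) (n - 1) = index_mod3 (n - m + 1).
Proof. exact: index_mod3_shift_t. Qed.

Lemma colour_tu (m n : int) : index_mod3 (n - m + 1) != index_mod3 (n - m - 1).
Proof. by have [q] := colour_step (n - m); case=> -[_ _ -> ->]. Qed.

Fact bool_cup_cap (R : comPzRingType) (a b c d : bool) : a || b = c || d -> a && b = c && d ->
  a%:R + b%:R = c%:R + d%:R :> R.
Proof. by case: a; case: b; case: c; case: d => //= _ _; rewrite ?addr0 ?add0r. Qed.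

Fact Ntheta_s_mul_arith (R : comPzRingType) (a b c d e E x w : R) : x * w = 1 -> b + c = d + e ->
  (a + w ^+ 2 * b) * E + x * (c * (E * w ^+ 3)) =
  a * E + d * (E * w ^+ 2) + e * (E * w ^+ 2).
Proof. by move=> xw /(canRL (addrK _)) ->; ring: xw. Qed.

(** By [hexS_t] the first part of the product is N_theta(m+1,n).  The second part is the
indicator function of a set which, together with the hexagon (m-1,n), has the same union and
intersection as the pair of hexagons (m,n) and (m-1,n+1). *)
Lemma Ntheta_s_mul_t (m n : int) : 0 <= m -> 0 <= n -> let t := index_mod3 (n - m + 1) in
  Ntheta_s m n * (H_ t + v%:A) + v *: Ntheta_s (m - 1) n =
  Ntheta (m + 1) n + Ntheta m n + Ntheta (m - 1) (n + 1).
Proof.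
move=> m0 n0 t; apply: hcoef_inj => z.
rewrite hcoef_comb2 (hcoef_graded_mulHv t z (hcoef_Ntheta_s m n)) (hcoef_Ntheta_s (m - 1) n).
rewrite hcoefD hcoefD (hcoef_Ntheta (m + 1) n) (hcoef_Ntheta m n) (hcoef_Ntheta (m - 1) (n + 1)).
have [ts us] := colour_neq m n.
rewrite colour_m1 (hexW_t z m0 n0) -/t (hexW_coset_min_colour _ m0 n0).
have tu : t != colour (m - 1) (n + 1) by rewrite colour_mnp; apply: colour_tu.
rewrite -(hexW_coset_min z ts) -(hexW_coset_min z tu).
have nd : ~~ desc (alc (coset_min z t)) t by rewrite -rdescE rdesc_coset_min.
have := hexS_cap_t m0 n0 nd; have := hexS_cup_t m0 n0 nd; rewrite -/t -!alc_s => hu hc.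
set E := v ^ (2 * m + 2 * n + 4 + 1 - (ell z)%:Z).
have -> : 2 * (m + 1) + 2 * n + 3 - (ell z)%:Z = 2 * m + 2 * n + 4 + 1 - (ell z)%:Z by lia.
have -> : 2 * m + 2 * n + 3 - (ell z)%:Z = 2 * m + 2 * n + 4 + 1 - (ell z)%:Z - 2%:Z by lia.
have -> : 2 * (m - 1) + 2 * (n + 1) + 3 - (ell z)%:Z =
  2 * m + 2 * n + 4 + 1 - (ell z)%:Z - 2%:Z by lia.
have -> : 2 * (m - 1) + 2 * n + 4 - (ell z)%:Z = 2 * m + 2 * n + 4 + 1 - (ell z)%:Z - 3%:Z by lia.
rewrite (vexpB _ 3) !(vexpB _ 2) -/E.
exact: (Ntheta_s_mul_arith _ _ mulvV (bool_cup_cap _ hu hc)).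
Qed.

Lemma Ntheta_s_mul_u (m n : int) : 0 <= m -> 0 <= n -> let u := index_mod3 (n - m - 1) in
  Ntheta_s m n * (H_ u + v%:A) + v *: Ntheta_s m (n - 1) =
  Ntheta m (n + 1) + Ntheta m n + Ntheta (m + 1) (n - 1).
Proof.
move=> m0 n0 u; apply: hcoef_inj => z.
rewrite hcoef_comb2 (hcoef_graded_mulHv u z (hcoef_Ntheta_s m n)) (hcoef_Ntheta_s m (n - 1)).
rewrite hcoefD hcoefD (hcoef_Ntheta m (n + 1)) (hcoef_Ntheta m n) (hcoef_Ntheta (m + 1) (n - 1)).
have [ts us] := colour_neq m n.
rewrite colour_n1 (hexW_u z m0 n0) -/u (hexW_coset_min_colour _ m0 n0).
have ut : u != colour (m + 1) (n - 1) by rewrite colour_mpn eq_sym; apply: colour_tu.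
rewrite -(hexW_coset_min z us) -(hexW_coset_min z ut).
have nd : ~~ desc (alc (coset_min z u)) u by rewrite -rdescE rdesc_coset_min.
have := hexS_cap_u m0 n0 nd; have := hexS_cup_u m0 n0 nd; rewrite -/u -!alc_s => hu hc.
set E := v ^ (2 * m + 2 * n + 4 + 1 - (ell z)%:Z).
have -> : 2 * m + 2 * (n + 1) + 3 - (ell z)%:Z = 2 * m + 2 * n + 4 + 1 - (ell z)%:Z by lia.
have -> : 2 * m + 2 * n + 3 - (ell z)%:Z = 2 * m + 2 * n + 4 + 1 - (ell z)%:Z - 2%:Z by lia.
have -> : 2 * (m + 1) + 2 * (n - 1) + 3 - (ell z)%:Z =
  2 * m + 2 * n + 4 + 1 - (ell z)%:Z - 2%:Z by lia.
have -> : 2 * m + 2 * (n - 1) + 4 - (ell z)%:Z = 2 * m + 2 * n + 4 + 1 - (ell z)%:Z - 3%:Z by lia.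
rewrite (vexpB _ 3) !(vexpB _ 2) -/E.
exact: (Ntheta_s_mul_arith _ _ mulvV (bool_cup_cap _ hu hc)).
Qed.

(** * Self-dual sums of the elements N *)

Fixpoint Ktheta_nat (m n : nat) : hecke :=
  N_ (theta m n) +
  (if m is m'.+1 then if n is n'.+1 then v ^+ 2 *: Ktheta_nat m' n' else 0 else 0).

Definition Ktheta (m n : int) : hecke :=
  match m, n with Posz m, Posz n => Ktheta_nat m n | _, _ => 0 end.

Lemma Ktheta_neg (m n : int) : ~~ ((0 <= m) && (0 <= n)) -> Ktheta m n = 0.
Proof. by case: m => // m; case: n. Qed.

Lemma Ktheta_rec (m n : int) : Ktheta m n = Ntheta m n + v ^+ 2 *: Ktheta (m - 1) (n - 1).
Proof.
have neg : ~~ ((0 <= m) && (0 <= n)) -> Ntheta m n = 0.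
  by case: (m) => // m'; case: (n).
have [mn|mn] := boolP ((0 <= m) && (0 <= n)); last first.
  rewrite (neg mn) (Ktheta_neg mn) (@Ktheta_neg (m - 1) (n - 1)); last by move: mn; lia.
  by rewrite scaler0 addr0.
have drop : ~~ ((0 < m) && (0 < n)) -> Ktheta (m - 1) (n - 1) = 0.
  by move=> h; apply: Ktheta_neg; move: h; lia.
case: m n mn neg drop => // -[|m] [] // n _ _ drop.
  by rewrite drop // scaler0.
case: n drop => [|n] drop; first by rewrite drop // scaler0.
have -> : m.+1%:Z - 1 = m by lia.
by have -> : n.+1%:Z - 1 = n by lia.
Qed.

(** The right-hand side of the theorem, with the sums [Ktheta] in place of the
Kazhdan-Lusztig elements. *)
Definition Ktheta_s (m n : int) : hecke :=
  Ntheta_s m n + v *: Ktheta (m - 1) n + v *: Ktheta m (n - 1).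

Lemma Ktheta_s_neg (m n : int) : ~~ ((0 <= m) && (0 <= n)) -> Ktheta_s m n = 0.
Proof.
move=> h; rewrite /Ktheta_s (@Ktheta_neg (m - 1) n) ?(@Ktheta_neg m (n - 1)); try (move: h; lia).
rewrite scaler0 2!addr0.
by case: m h => // m; case: n.
Qed.

Fact alg_scaleAl (h x : hecke) (c : laurent) : (c *: h) * x = c *: (h * x).
Proof. exact: esym (scalerAl c h x). Qed.

(** The term -v^2 S' of the product for (m,n) cancels against the leading term of the
product for (m-1,n-1). *)
Fact telescope_step (R : comNzRingType) (V : lmodType R) (x : R) (S N1 N2 S' K1 K2 : V) :
  S + x *: N1 + x *: N2 - x ^+ 2 *: S' + x ^+ 2 *: (S' + x *: K1 + x *: K2) =
  S + x *: (N1 + x ^+ 2 *: K1) + x *: (N2 + x ^+ 2 *: K2).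
Proof.
rewrite !scalerDr !scalerA !addrA addrNK [x ^+ 2 * x]mulrC; congr (_ + _).
exact: addrAC.
Qed.

(** The factor x (x + w) with x w = 1 comes from an element C on which H_i + v acts as the
scalar v + v^-1; it contributes x^2 C to the first sum and a further C. *)
Fact lmod_regroup (R : comNzRingType) (V : lmodType R) (x w : R) (N1 N2 N3 S A B C : V) :
  x * w = 1 ->
  N1 + N2 + N3 - x *: S + x *: (S + x *: A + x *: B) + (x * (x + w)) *: C =
  (N1 + x ^+ 2 *: C) + (N2 + x ^+ 2 *: B) + (N3 + x ^+ 2 *: A) + C.
Proof.
move=> xw; rewrite mulrDr xw scalerDl scale1r -expr2 !scalerDr !scalerA -expr2.
rewrite !addrA addrNK; congr (_ + _).
by rewrite [LHS](ACl (1 * 6 * 2 * 5 * 3 * 4))%AC.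
Qed.

(** All summands of K(m,n) have the same colour, so the first product formula applies to
each of them and the negative terms telescope. *)
Lemma Ktheta_mul_s (m n : int) : Ktheta m n * (H_ (colour m n) + v%:A) = Ktheta_s m n.
Proof.
have [k] := ubnP `|m|%N; elim: k m n => // k IHk m n; rewrite ltnS => mk.
have [mn|mn] := boolP ((0 <= m) && (0 <= n)); last first.
  by rewrite (Ktheta_neg mn) (Ktheta_s_neg mn) mul0r.
have [m0 n0] := andP mn.
have IH : Ktheta (m - 1) (n - 1) * (H_ (colour m n) + v%:A) = Ktheta_s (m - 1) (n - 1).
  have [m1|m1] := boolP (0 < m); first by rewrite -colour_mn1 IHk //; lia.
  by rewrite (@Ktheta_neg (m - 1)) ?(@Ktheta_s_neg (m - 1)) ?mul0r //; move: m1; lia.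
rewrite (Ktheta_rec m n) mulrDl (Ntheta_mul_s m0 n0).
rewrite (alg_scaleAl (Ktheta (m - 1) (n - 1)) _ (v ^+ 2)) IH.
rewrite /Ktheta_s (Ktheta_rec (m - 1) n) (Ktheta_rec m (n - 1)).
exact: telescope_step.
Qed.

(** Lower intervals of theta(m,n) are stable under its right descents, which makes the
indicator function chi of [hcoef_graded_mulHv] constant on the pairs {z, z s_i}. *)
Lemma Ntheta_mul_desc (m n : int) i : i != colour m n ->
  Ntheta m n * (H_ i + v%:A) = (v + v^-1) *: Ntheta m n.
Proof.
move=> ic; apply: hcoef_inj => z.
rewrite (hcoef_graded_mulHv i z (hcoef_Ntheta m n)) (hcoefZ z (v + v^-1) (Ntheta m n))
  (hcoef_Ntheta m n).
rewrite (hexW_s _ ic) (hexW_coset_min _ ic).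
have -> : 2 * m + 2 * n + 3 - (ell z)%:Z = 2 * m + 2 * n + 3 + 1 - (ell z)%:Z - 1%:Z by lia.
rewrite (vexpB _ 1); set E := v ^ _; move: E (hexW m n z)%:R => E b; have e := mulvV.
ring: e.
Qed.

Fact scaler_factor (R : comNzRingType) (V : lmodType R) (x y : R) (A B : V) :
  x *: A + y *: (x *: B) = x *: (A + y *: B).
Proof. by rewrite scalerDr !scalerA mulrC. Qed.

Lemma Ktheta_mul_desc (m n : int) i : i != colour m n ->
  Ktheta m n * (H_ i + v%:A) = (v + v^-1) *: Ktheta m n.
Proof.
have [k] := ubnP `|m|%N; elim: k m n => // k IHk m n; rewrite ltnS => mk ic.
have [mn|mn] := boolP ((0 <= m) && (0 <= n)); last by rewrite (Ktheta_neg mn) mul0r scaler0.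
have IH : Ktheta (m - 1) (n - 1) * (H_ i + v%:A) = (v + v^-1) *: Ktheta (m - 1) (n - 1).
  have [m1|m1] := boolP (0 < m); first by apply: IHk; rewrite ?colour_mn1 //; lia.
  by rewrite (@Ktheta_neg (m - 1)) ?mul0r ?scaler0 //; move: m1; lia.
rewrite (Ktheta_rec m n) mulrDl (Ntheta_mul_desc ic).
rewrite (alg_scaleAl (Ktheta (m - 1) (n - 1)) _ (v ^+ 2)) IH.
exact: scaler_factor.
Qed.

Fact lalg_regroup_t (R : comNzRingType) (L : lalgType R) (x w : R)
    (h P K1 K2 N1 N2 N3 S A B C : L) : x * w = 1 ->
  P * h + x *: S = N1 + N2 + N3 -> K1 * h = S + x *: A + x *: B -> K2 * h = (x + w) *: C ->
  (P + x *: K1 + x *: K2) * h =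
  (N1 + x ^+ 2 *: C) + (N2 + x ^+ 2 *: B) + (N3 + x ^+ 2 *: A) + C.
Proof.
move=> xw /(canRL (addrK _)) e e1 e2.
rewrite !mulrDl -!scalerAl e e1 e2 [x *: ((x + w) *: C)]scalerA.
exact: lmod_regroup.
Qed.

Fact lalg_regroup_u (R : comNzRingType) (L : lalgType R) (x w : R)
    (h P K1 K2 N1 N2 N3 S A B C : L) : x * w = 1 ->
  P * h + x *: S = N1 + N2 + N3 -> K2 * h = S + x *: B + x *: A -> K1 * h = (x + w) *: C ->
  (P + x *: K1 + x *: K2) * h =
  (N1 + x ^+ 2 *: C) + (N2 + x ^+ 2 *: B) + (N3 + x ^+ 2 *: A) + C.
Proof.
move=> xw e e1 e2; rewrite [_ + _ + x *: K2]addrAC.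
by apply: lalg_regroup_t xw e _ e2; rewrite e1 addrAC.
Qed.

(** H_t + v turns K(m-1,n) into G(m-1,n), as t is its colour, and K(m,n-1) into a scalar
multiple, as t is a descent.  The first cancels the correction in [Ntheta_s_mul_t], and the rest
is regrouped into the sums K. *)
Lemma Ktheta_s_mul_t (m n : int) : 0 <= m -> 0 <= n ->
  Ktheta_s m n * (H_ (index_mod3 (n - m + 1)) + v%:A) =
  Ktheta (m + 1) n + Ktheta m n + Ktheta (m - 1) (n + 1) + Ktheta m (n - 1).
Proof.
move=> m0 n0.
have e1 : Ktheta (m - 1) n * (H_ (index_mod3 (n - m + 1)) + v%:A) = Ktheta_s (m - 1) n.
  by rewrite -colour_m1; apply: Ktheta_mul_s.
have e2 : Ktheta m (n - 1) * (H_ (index_mod3 (n - m + 1)) + v%:A) =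
  (v + v^-1) *: Ktheta m (n - 1).
  by apply: Ktheta_mul_desc; rewrite colour_n1; apply: colour_tu.
rewrite (Ktheta_rec (m + 1) n) (Ktheta_rec m n) (Ktheta_rec (m - 1) (n + 1)) !addrK.
exact: (lalg_regroup_t mulvV (Ntheta_s_mul_t m0 n0) e1 e2).
Qed.

Lemma Ktheta_s_mul_u (m n : int) : 0 <= m -> 0 <= n ->
  Ktheta_s m n * (H_ (index_mod3 (n - m - 1)) + v%:A) =
  Ktheta m (n + 1) + Ktheta m n + Ktheta (m + 1) (n - 1) + Ktheta (m - 1) n.
Proof.
move=> m0 n0.
have e1 : Ktheta m (n - 1) * (H_ (index_mod3 (n - m - 1)) + v%:A) = Ktheta_s m (n - 1).
  by rewrite -colour_n1; apply: Ktheta_mul_s.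
have e2 : Ktheta (m - 1) n * (H_ (index_mod3 (n - m - 1)) + v%:A) =
  (v + v^-1) *: Ktheta (m - 1) n.
  by apply: Ktheta_mul_desc; rewrite colour_m1 eq_sym; apply: colour_tu.
rewrite (Ktheta_rec m (n + 1)) (Ktheta_rec m n) (Ktheta_rec (m + 1) (n - 1)) !addrK.
exact: (lalg_regroup_u mulvV (Ntheta_s_mul_u m0 n0) e1 e2).
Qed.

(** * Self-duality *)

Lemma bar_Hv i : bar (H_ i + v%:A) = H_ i + v%:A.
Proof.
have e1 : bar v%:A = v^-1%:A := proj1 bar_is_bar.
rewrite (rmorphD bar) /= barH e1 /Hinv /q scalerBl opprB.
by rewrite -addrA [v%:A - _ + _]addrNK.
Qed.

Definition bar_fixed (h : hecke) : Prop := bar h = h.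

Lemma bar_fixed_mulHv h i : bar_fixed h -> bar_fixed (h * (H_ i + v%:A)).
Proof. by rewrite /bar_fixed (rmorphM bar) => bh; congr (_ * _); [exact: bh|exact: bar_Hv]. Qed.

Lemma bar_fixedB h h' : bar_fixed h -> bar_fixed h' -> bar_fixed (h - h').
Proof. by rewrite /bar_fixed (rmorphB bar) => bh bh'; congr (_ - _); [exact: bh|exact: bh']. Qed.

Definition is_alcove0 (A : alcove) : bool :=
  (px A == 0) && (py A == 0) && (if dir A is Oe then true else false).

Lemma eq1_alc y : (y == 1%g) = is_alcove0 (alc y).
Proof.
apply/eqP/idP => [->|]; first by rewrite alc1.
rewrite /is_alcove0 => h; apply: alc_inj; rewrite alc1.
by case: (alc y) h => a b [] /andP[/andP[/eqP /= -> /eqP ->]].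
Qed.

Definition coset_min_alc (A : alcove) i := if desc A i then act A i else A.
Lemma alc_coset_min z i : alc (coset_min z i) = coset_min_alc (alc z) i.
Proof. by rewrite /coset_min /coset_min_alc -rdescE; case: ifP => // _; rewrite alc_s. Qed.

(** Three applications of [hcoef_graded_mulHv] to the indicator function of 1 produce the
bracket; the Booleans are the values of that indicator function at the elements reached from z
by three steps, and only their counts matter. *)
Fact hexagon_arith (R : comPzRingType) (E w : R) (a b c d e f g h k l m : bool) :
  a = b -> (c + d + f = l)%N -> (e + g + h = m)%N -> k = false ->
  a%:R * E = (b%:R + w ^+ 2 * c%:R + w ^+ 2 * (d%:R + w ^+ 2 * e%:R) +
    w ^+ 2 * (f%:R + w ^+ 2 * g%:R + w ^+ 2 * (h%:R + w ^+ 2 * k%:R))) * E -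
    (l%:R + w ^+ 2 * m%:R) * (E * w ^+ 2).
Proof.
by move=> -> <- <- ->; rewrite !natrD mulr0n; ring.
Qed.

(** The base of the induction: K(0,0) = N_(s1 s2 s1), which is the Kazhdan-Lusztig element of the
longest element of the finite Weyl group.  The coefficients at z can be nonzero only for the six
alcoves around the origin. *)
Lemma Ktheta00_product :
  Ktheta 0 0 = 1 * (H_ gen1 + v%:A) * (H_ gen2 + v%:A) * (H_ gen1 + v%:A) - 1 * (H_ gen1 + v%:A).
Proof.
apply: hcoef_inj => z; rewrite hcoefB.
have h0 y : hcoef y 1 = (is_alcove0 (alc y))%:R * v ^ (0 - (ell y)%:Z).
  rewrite hcoef1 -eq1_alc; case: eqVneq => [->|]; last by rewrite !mul0r.
  by rewrite ell1 mul1r.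
have h1 y := hcoef_graded_mulHv gen1 y h0.
have h2 y := hcoef_graded_mulHv gen2 y h1.
apply: (eq_trans _ (esym (f_equal2 (fun a b => a - b) (hcoef_graded_mulHv gen1 z h2) (h1 z)))).
have -> : Ktheta 0 0 = Ntheta 0 0 by rewrite Ktheta_rec (@Ktheta_neg (0 - 1)) // scaler0 addr0.
rewrite (hcoef_Ntheta 0 0).
have -> : 0 + 1 - (ell z)%:Z = 0 + 1 + 1 + 1 - (ell z)%:Z - 2%:Z by lia.
rewrite (vexpB _ 2) (_ : 2 * 0 + 2 * 0 + 3 - (ell z)%:Z = 0 + 1 + 1 + 1 - (ell z)%:Z) //.
have [E <-] : exists x : laurent, x = v ^ (0 + 1 + 1 + 1 - (ell z)%:Z) by eexists.
have [w <-] : exists x : laurent, x = v^-1 by eexists.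
rewrite /hexW hex00 !(alc_coset_min, alc_s).
have [xy|xy] := boolP ((px (alc z) == 0) && (py (alc z) == 0)).
  have [o ->] : exists o, alc z = Alcove 0 0 o.
    by case: (alc z) xy => x y o /andP[/eqP /= -> /eqP /= ->]; exists o.
  by case: o; apply: hexagon_arith; vm_compute.
have keep A i : i != gen0 ->
    (px (coset_min_alc A i) = px A) * (py (coset_min_alc A i) = py A) *
    (px (act A i) = px A) * (py (act A i) = py A).
  by rewrite /coset_min_alc; case: (desc A i); move: A; elim/ord3_ind: i => -[x y []].
have z0 A : px A = px (alc z) -> py A = py (alc z) -> is_alcove0 A = false.
  by rewrite /is_alcove0 => -> ->; rewrite (negPf xy).
have p1 A := keep A gen1 isT; have p2 A := keep A gen2 isT.
(* Away from the origin all values of the indicator function of 1 vanish. *)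
repeat match goal with |- context [is_alcove0 ?A] =>
  let H := fresh in assert (H : is_alcove0 A = false) by
    (apply: z0; rewrite ?p1 ?p2 ?p1 ?p2 ?p1 ?p2; reflexivity);
  revert H; generalize (is_alcove0 A); intros ? -> end.
by apply: hexagon_arith.
Qed.

Lemma bar_fixed_Ktheta_s (m n : int) : bar_fixed (Ktheta m n) -> bar_fixed (Ktheta_s m n).
Proof. by move=> h; rewrite -Ktheta_mul_s; apply: bar_fixed_mulHv. Qed.

Fact eq_subr3 (V : zmodType) (a b c d g : V) : g = a + b + c + d -> a = g - d - c - b.
Proof. by move=> ->; rewrite !addrK. Qed.

(** Induction on m + n.  The product G(m,n-1) (H_u + v) expresses K(m,n) through a self-dual
element and sums K with smaller m + n; when n = 0 the product G(m-1,0) (H_t + v) is used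
instead. *)
Lemma bar_fixed_Ktheta (m n : int) : bar_fixed (Ktheta m n).
Proof.
have neg (a b : int) : ~~ ((0 <= a) && (0 <= b)) -> bar_fixed (Ktheta a b).
  by move=> h; rewrite (Ktheta_neg h) /bar_fixed; apply: (raddf0 bar).
have [k] := ubnP (`|m| + `|n|)%N; elim: k m n => // k IHk m n; rewrite ltnS => mk.
have [mn|/neg //] := boolP ((0 <= m) && (0 <= n)).
have [m0 n0] := andP mn.
have IH (a b : int) : a + b < m + n -> bar_fixed (Ktheta a b).
  move=> ab; have [ab0|/neg //] := boolP ((0 <= a) && (0 <= b)).
  by apply: IHk; move: ab0; lia.
have [n1|n1] := boolP (0 < n).
  have m0' : 0 <= n - 1 by lia.
  have := Ktheta_s_mul_u m0 m0'; rewrite subrK => /eq_subr3 ->.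
  apply: bar_fixedB; [apply: bar_fixedB; [apply: bar_fixedB|]|]; try (apply: IH; lia).
  by apply/bar_fixed_mulHv/bar_fixed_Ktheta_s/IH; lia.
have [m1|m1] := boolP (0 < m).
  have m0' : 0 <= m - 1 by lia.
  have := Ktheta_s_mul_t m0' n0; rewrite subrK => /eq_subr3 ->.
  apply: bar_fixedB; [apply: bar_fixedB; [apply: bar_fixedB|]|]; try (apply: IH; lia).
  by apply/bar_fixed_mulHv/bar_fixed_Ktheta_s/IH; lia.
have -> : m = 0 by lia.
have -> : n = 0 by lia.
rewrite Ktheta00_product.
have b1 : bar_fixed 1 by apply: (rmorph1 bar).
by apply: bar_fixedB; do ?apply: bar_fixed_mulHv.
Qed.

(** * The Kazhdan-Lusztig elements of theta(m,n) and theta(m,n)s *)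

Lemma N_vZ w z : exists p, hcoef z (N_ w) = (z == w)%:R + v * poly_v p.
Proof.
rewrite hcoef_N; case: eqVneq => [->|zw].
  exists 0; rewrite (asboolT (BruhatRefl w)) subnn expr0.
  by rewrite poly_v0 mulr0 addr0.
case: asboolP => [/bruhat_ell[e|lt]|_]; first by rewrite e eqxx in zw.
  exists 'X^((ell w - ell z).-1); rewrite add0r poly_vE poly_atXn -exprS.
  by rewrite prednK ?subn_gt0.
by exists 0; rewrite poly_v0 mulr0 addr0.
Qed.

Lemma N_supp w z : ~ bruhat_le z w -> hcoef z (N_ w) = 0.
Proof. by move=> nz; rewrite hcoef_N; case: asboolP. Qed.

Lemma N_top w : hcoef w (N_ w) = 1.
Proof. by rewrite hcoef_N (asboolT (BruhatRefl w)) subnn expr0. Qed.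

Lemma poly_v_bool (b : bool) : poly_v b%:R = b%:R.
Proof. by rewrite poly_vE; case: b; rewrite ?poly_at1 // -?poly_vE ?poly_v0. Qed.

(** The hexagons (m-i,n-i) are nested, so all summands are supported below theta(m,n). *)
Lemma Ktheta_supp (m n : int) z : ~~ hexW m n z -> hcoef z (Ktheta m n) = 0.
Proof.
have [k] := ubnP `|m|%N; elim: k m n => // k IHk m n; rewrite ltnS => mk hz.
have [mn|mn] := boolP ((0 <= m) && (0 <= n)); last by rewrite (Ktheta_neg mn) hcoef0.
rewrite Ktheta_rec hcoef_comb2 hcoef_Ntheta (negPf hz) mul0r add0r.
have [m1|m1] := boolP (0 < m); last first.
  by rewrite Ktheta_neg ?hcoef0 ?mulr0 //; move: m1; lia.
rewrite IHk ?mulr0 //; first by lia.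
apply: contra hz => /(@hex_step _ _ (alc z)).
by rewrite !subrK.
Qed.

Lemma Ktheta_vZ (m n : nat) z : exists p,
  hcoef z (Ktheta m n) = (z == theta m n)%:R + v * poly_v p.
Proof.
elim: m n => [|m IHm] n; first by rewrite /= addr0; case: n => [|n] /=; apply: N_vZ.
case: n => [|n]; first by rewrite /= addr0; apply: N_vZ.
have [p e] := N_vZ (theta m.+1 n.+1) z; have [p' e'] := IHm n.
exists (p + 'X * ((z == theta m n)%:R + 'X * p')).
rewrite /= hcoef_comb2 e e' !poly_vE !(poly_atD, poly_atM, poly_atX) -!poly_vE poly_v_bool.
by ring.
Qed.

Lemma Ktheta_top (m n : nat) : hcoef (theta m n) (Ktheta m n) = 1.
Proof.
rewrite Ktheta_rec hcoef_comb2 Ktheta_supp ?mulr0 ?addr0; first exact: N_top.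
case: m => [|m]; first by rewrite hexW_neg.
case: n => [|n]; first by rewrite hexW_neg // andbF.
have -> : m.+1%:Z - 1 = m by lia.
have -> : n.+1%:Z - 1 = n by lia.
apply/negP => /bruhat_theta/bruhat_ell[/(congr1 ell)|]; rewrite !ell_theta; lia.
Qed.

Lemma KL_thetaE (m n : nat) : KL (theta m n) = Ktheta m n.
Proof.
apply: KL_intro; first exact: bar_fixed_Ktheta.
- exact: Ktheta_top.
- by move=> z nz; apply: Ktheta_supp; apply/negP => /bruhat_theta.
- exact: Ktheta_vZ.
Qed.

Lemma KL_theta_Ktheta (m n : int) : KL_theta m n = Ktheta m n.
Proof. by case: m n => [m|m] [n|n] //=; apply: KL_thetaE. Qed.

Lemma Ktheta_poly (m n : int) z : exists p, hcoef z (Ktheta m n) = poly_v p.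
Proof.
have neg : Ktheta m n = 0 -> exists p, hcoef z (Ktheta m n) = poly_v p.
  by move=> ->; exists 0; rewrite hcoef0 poly_v0.
case: m n neg => [m|m] [n|n] neg; [|exact: neg|exact: neg|exact: neg].
have [p e] := Ktheta_vZ m n z; exists ((z == theta m n)%:R + 'X * p).
by rewrite e !poly_vE poly_atD poly_atM poly_atX -!poly_vE poly_v_bool.
Qed.

(** The two smaller hexagons are the places where one can move up across the wall of type
s and stay in the hexagon (m,n); so they are contained in it. *)
Lemma hexW_bruhat_theta_s (m n : nat) z :
  hexW (m%:Z - 1) n z || hexW m (n%:Z - 1) z -> bruhat_le z (theta_s m n).
Proof.
have [ct cu] := colour_neq m n; have m0 := le0z_nat m; have n0 := le0z_nat n.
set s := colour m n in ct cu.
have e1 : hexW (m%:Z - 1) n (coset_min z s) = hexW (m%:Z - 1) n z.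
  by apply: hexW_coset_min; rewrite colour_m1 eq_sym.
have e2 : hexW m (n%:Z - 1) (coset_min z s) = hexW m (n%:Z - 1) z.
  by apply: hexW_coset_min; rewrite colour_n1 eq_sym.
rewrite -e1 -e2 /hexW.
have nd : ~~ desc (alc (coset_min z s)) s by rewrite -rdescE rdesc_coset_min.
rewrite -(hex_upper m0 n0 nd) => /(hex_closed m0 n0 nd) h.
by apply/bruhat_theta_s.
Qed.

Lemma KL_theta_sE (m n : nat) : KL (theta_s m n) = Ktheta_s m n.
Proof.
apply: KL_intro; first by apply/bar_fixed_Ktheta_s/bar_fixed_Ktheta.
(* The terms K(m-1,n) and K(m,n-1) only involve elements shorter than theta(m,n)s. *)
- have ge z : (ell (theta_s m n) <= ell z)%N ->
      hcoef z (Ktheta (m%:Z - 1) n) = 0 /\ hcoef z (Ktheta m (n%:Z - 1)) = 0.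
    move=> le; split; apply: Ktheta_supp; apply: contraTN le => h; rewrite -ltnNge.
      case: m h => [|m] h; first by rewrite hexW_neg in h.
      have em : m.+1%:Z - 1 = m by lia.
      rewrite em in h; move/bruhat_theta: h => /bruhat_ell[->|]; rewrite ell_theta_s ell_theta;
        lia.
    case: n h => [|n] h; first by rewrite hexW_neg ?andbF in h.
    have en : n.+1%:Z - 1 = n by lia.
    rewrite en in h; move/bruhat_theta: h => /bruhat_ell[->|]; rewrite ell_theta_s ell_theta; lia.
  have [e1 e2] := ge _ (leqnn _).
  by rewrite /Ktheta_s 2!hcoef_comb2 e1 e2 !mulr0 !addr0; apply: N_top.
- move=> z nz; rewrite /Ktheta_s 2!hcoef_comb2 (N_supp nz) !Ktheta_supp ?mulr0 ?addr0 //;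
    by apply/negP => h; apply: nz; apply: hexW_bruhat_theta_s; rewrite h ?orbT.
- move=> z; rewrite /Ktheta_s 2!hcoef_comb2.
  have [p e] := N_vZ (theta_s m n) z; have [p1 e1] := Ktheta_poly (m%:Z - 1) n z.
  have [p2 e2] := Ktheta_poly m (n%:Z - 1) z; exists (p + p1 + p2).
  by rewrite /= e e1 e2 !poly_vE !poly_atD; ring.
Qed.

(** The generators other than the colour preserve the lower interval of theta(m,n), hence are
right descents. *)
Lemma theta_ascent (m n : nat) i :
  (ell (theta m n) < ell (theta m n * s_ i)%g)%N -> i = colour m n.
Proof.
move=> lt; apply/eqP; apply: contraTT lt => ic; rewrite -leqNgt.
have : hexW m n (theta m n * s_ i)%g.
  by rewrite (hexW_s _ ic); apply/bruhat_theta/BruhatRefl.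
by move/bruhat_theta => /bruhat_ell[->|/ltnW].
Qed.

Theorem proposition3p1 (m n : nat) (i : 'I_3)
    (hi : (ell (theta m n) < ell (theta m n * s_ i)%g)%N) :
  KL (theta m n * s_ i)%g
  = N_ (theta m n * s_ i)%g + v *: KL_theta (m%:Z - 1) n%:Z
    + v *: KL_theta m%:Z (n%:Z - 1).
Proof.
rewrite (theta_ascent hi) (KL_theta_Ktheta (m%:Z - 1) n) (KL_theta_Ktheta m (n%:Z - 1)).
exact: KL_theta_sE.
Qed.
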